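(* Let $(X_n)_{n\in\mathbb{Z}_+}$ be an inhomogeneous INAR(1) process with offspring means $\varrho_n=\mathsf{E}\xi_{n,1}$ and immigration variables $\varepsilon_n$, and let $m_{n,j}=\mathsf{E}\varepsilon_n(\varepsilon_n-1)\cdots(\varepsilon_n-j+1)$ for $n,j\in\mathbb{N}$. Assume that (i) $\varrho_n<1$ for all $n\in\mathbb{N}$, $\lim_{n\to\infty}\varrho_n=1$, and $\sum_{n=1}^\infty(1-\varrho_n)=\infty$; (ii) $\lim_{n\to\infty}\frac{m_{n,j}}{j(1-\varrho_n)}=\lambda_j\in[0,\infty)$ for all $j\in\mathbb{N}$, such that the limits (sums of infinite series, understood as limits of partial sums) $$\mu\{j\}:=\frac{1}{j!}\sum_{i=0}^{\infty}\frac{(-1)^i}{i!}\lambda_{j+i},\qquad j\in\mathbb{N},$$ exist. Then $X_n$ converges in distribution to $\mathrm{CP}(\mu)$ as $n\to\infty$ (the assertion includes that $\mu$ is a finite measure on $\mathbb{N}$, so that $\mathrm{CP}(\mu)$ is defined).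
   Context: An inhomogeneous INAR(1) process $(X_n)_{n\in\mathbb{Z}_+}$ is defined by $X_0=0$ and $X_n=\sum_{j=1}^{X_{n-1}}\xi_{n,j}+\varepsilon_n$ for $n\in\mathbb{N}$, where $\{\xi_{n,j},\varepsilon_n:n,j\in\mathbb{N}\}$ are independent non-negative integer-valued random variables such that, for each $n\in\mathbb{N}$, the variables $\{\xi_{n,j}:j\in\mathbb{N}\}$ are identically distributed and $\mathsf{P}(\xi_{n,1}\in\{0,1\})=1$. The offspring means are $\varrho_n:=\mathsf{E}\xi_{n,1}\in[0,1]$. For a finite measure $\mu$ on $\mathbb{Z}_+$ (a measure on $\mathbb{N}$ being extended by $0$), the compound Poisson distribution $\mathrm{CP}(\mu)$ with intensity measure $\mu$ is the probability measure on $\mathbb{Z}_+$ with generating function $z\mapsto\exp\{\sum_{j=1}^\infty\mu\{j\}(z^j-1)\}$ for $z\in\mathbb{C}$, $|z|\le 1$. *)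

(* Defs.v *)
From HB Require Import structures.
From mathcomp Require Import all_boot all_order all_algebra finmap.
From mathcomp Require Import all_classical all_reals all_analysis.
From mathcomp Require Import complex.

Set Implicit Arguments.
Unset Strict Implicit.
Unset Printing Implicit Defensive.

Import Order.TTheory GRing.Theory Num.Theory.
Import numFieldNormedType.Exports.

Local Open Scope classical_set_scope.
Local Open Scope ring_scope.
Local Open Scope complex_scope.

(* Mutual independence of the subfamily (Y i), i \in D, of random variables
   with values in a common measurable space: the product rule holds over every
   finite set of indices. *)
Definition mutually_independent d d' (T : measurableType d)
    (T' : measurableType d') (R : realType) (P : probability T R)
    (I : choiceType) (D : set I) (Y : I -> {RV P >-> T'}) : Prop :=
  forall (J : {fset I}) (A : I -> set T'),
    (forall i, i \in J -> D i) -> (forall i, i \in J -> measurable (A i)) ->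
    (P (\bigcap_(i in [set` J]) Y i @^-1` A i) =
     \prod_(i <- J) P (Y i @^-1` A i))%E.

Definition weakly_converges (R : realType) (Q : nat -> probability nat R)
    (Q0 : probability nat R) : Prop :=
  forall f : nat -> R, continuous f -> (exists M : R, forall k, `|f k| <= M) ->
    ((\int[Q n]_k (f k)%:E) @[n --> \oo] --> \int[Q0]_k (f k)%:E)%E.

Definition converges_in_distribution d (T : measurableType d) (R : realType)
    (P : probability T R) (X : nat -> {RV P >-> nat})
    (Q : probability nat R) : Prop :=
  weakly_converges (fun n => distribution P (X n)) Q.

Section INAR.
Context d (T : measurableType d) (R : realType) (P : probability T R).
Variables (xi : nat -> nat -> {RV P >-> nat}) (eps X : nat -> {RV P >-> nat}).

(* The offspring variables xi n j and the immigration variables eps n as one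
   family.  Only the indices n, j >= 1 are meaningful. *)
Definition inar_input (i : nat * nat + nat) : {RV P >-> nat} :=
  match i with inl nj => xi nj.1 nj.2 | inr n => eps n end.

Definition inar_index : set (nat * nat + nat) :=
  [set i | match i with
           | inl nj => (0 < nj.1)%N && (0 < nj.2)%N
           | inr n => (0 < n)%N
           end].

Record inhomogeneous_INAR1 : Prop := {
  inar_indep : mutually_independent inar_index inar_input ;
  inar_ident : forall n j, (0 < n)%N -> (0 < j)%N ->
    distribution P (xi n j) =1 distribution P (xi n 1) ;
  inar_bernoulli : forall n, (0 < n)%N ->
    P [set w | xi n 1 w \in [:: 0%N; 1%N]] = 1%E ;
  inar_init : forall w, X 0 w = 0%N ;
  inar_step : forall n w, (0 < n)%N ->
    X n w = (\sum_(1 <= j < (X n.-1 w).+1) xi n j w + eps n w)%N }.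

(* The expectation is finite whenever xi n 1 is almost surely 0-1 valued. *)
Definition offspring_mean (n : nat) : R :=
  fine ('E_P[fun w => (xi n 1 w)%:R])%E.

(* y ^_ j = y (y - 1) ... (y - j + 1); the moment may be infinite. *)
Definition factorial_moment (n j : nat) : \bar R :=
  ('E_P[fun w => ((eps n w) ^_ j)%:R])%E.

End INAR.

Section CompoundPoisson.
Context (R : realType).

Definition cexp (z : R[i]) : R[i] :=
  (expR (complex.Re z))%:C * (cos (complex.Im z) +i* sin (complex.Im z)).

Definition generating_function (Q : probability nat R) (z : R[i]) : R[i] :=
  limn (series (fun k => (fine (Q [set k]))%:C * z ^+ k : R[i]^o)).

(* The summation index is shifted: the sum runs over j >= 1. *)
Definition is_compound_poisson (mu : {finite_measure set nat -> \bar R})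
    (Q : probability nat R) : Prop :=
  forall z : R[i], `|z| <= 1 ->
    generating_function Q z =
    cexp (limn (series (fun j =>
      (fine (mu [set j.+1]))%:C * (z ^+ j.+1 - 1) : R[i]^o))).

Definition intensity_term (lam : nat -> R) (j i : nat) : R :=
  (-1) ^+ i / i`!%:R * lam (j + i)%N.

Definition intensity_mass (lam : nat -> R) (j : nat) : R :=
  (j`!%:R)^-1 * limn (series (intensity_term lam j)).

End CompoundPoisson.

(* Main.v *)
(** The generating function of X_n is the product over k <= n of those of the
    binomial thinnings of eps_k by rho_{k+1} ... rho_n, i.e. the immigrants of
    time k surviving at time n.  Let mu_n{j}, j >= 1, be the sum over k of the
    probabilities that j of them survive.  Its factorial moments are
    sum_k m_{k,i} (rho_{k+1} ... rho_n)^i, which tend to lambda_i by a Toeplitz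
    argument, so the Bonferroni inequalities squeeze mu_n{j} between truncations
    of the inclusion-exclusion series and mu_n{j} -> mu{j}; bounded first moments
    give tightness.  As the individual factors tend uniformly to 1, the product
    tends to exp(sum_j mu{j} (z^j - 1)) for every |z| <= 1, and the real values
    of z already force the probabilities P(X_n = k) to converge to a probability
    distribution, which is then CP(mu).  A fixed eps_k may have infinite moments;
    its contribution vanishes because rho_{k+1} ... rho_n -> 0. *)

(* Survival probabilities obey a first-order recursion in n, so sums over cohorts of immigrants are
   Toeplitz averages; the j in the denominator of (ii) is the limit of (1 - rho^j)/(1 - rho).
   Hypothesis (ii) makes the factorial moments of each order finite only from some time on, and that
   time depends on the order. Hence moment estimates are made for the cohorts from some K on, with K
   chosen for the orders at hand, and the earlier cohorts are handled by dominated convergence. The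
   series for mu may converge only conditionally, so it cannot be exchanged with the limit in n: n
   tends to infinity for a fixed truncation, and truncations of both parities then enclose the
   limit. Replacing a factor 1 + x by exp x costs a multiple of the squared probability that the
   cohort has a survivor; by Markov's inequality this is controlled by the squared mean number of
   survivors, and these squares sum to o(1) because the mean immigration tends to 0. No mass escapes
   because mu has mean at most lambda_1, so that exp(sum_j mu{j} (x^j - 1)) >= 1 - lambda_1 (1 - x)
   for 0 < x < 1. *)
Require Import Defs.
From HB Require Import structures.
From mathcomp Require Import all_boot all_order all_algebra finmap.
From mathcomp Require Import all_classical all_reals all_analysis.
From mathcomp Require Import complex.
From mathcomp Require Import ring lra zify.

Set Implicit Arguments.
Unset Strict Implicit.
Unset Printing Implicit Defensive.

Import Order.TTheory GRing.Theory Num.Theory.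
Import numFieldNormedType.Exports.

Local Open Scope classical_set_scope.
Local Open Scope ring_scope.

(** * Summable real sequences *)

Section RealSeries.
Context (R : realType).
Implicit Types (u v : nat -> R).

Lemma cvgnP (u : nat -> R) (l : R) : u @ \oo --> l <->
  forall e, 0 < e -> exists N, forall n, (N <= n)%N -> `|u n - l| <= e.
Proof.
split=> [/cvgrPdist_le h e e0|h].
- have [N _ hN] := h e e0; exists N => n Nn.
  by rewrite distrC; exact: (hN n Nn).
- apply/cvgrPdist_le => e e0; have [N hN] := h e e0.
  by exists N => // n /= Nn; rewrite distrC; apply: hN.
Qed.

Definition tsum u : R := limn (series u).

(** Bounded partial sums instead of a convergence statement, so that comparisons and Cauchy products
    reduce to estimates of finite sums. *)
Definition abs_summable u :=
  exists C, forall n, \sum_(0 <= k < n) `|u k| <= C.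

Lemma ler_sum_widen u m n : (forall k, 0 <= u k) -> (m <= n)%N ->
  \sum_(0 <= k < m) u k <= \sum_(0 <= k < n) u k.
Proof.
move=> u0 mn; rewrite (big_cat_nat (leq0n _) mn) //= lerDl.
exact: sumr_ge0.
Qed.

Lemma abs_summable_cvg u : abs_summable u -> cvgn (series u).
Proof.
move=> [C hC]; apply: normed_cvg; apply: nondecreasing_is_cvgn.
- by move=> m n mn; apply: (@ler_sum_widen (fun k => `|u k|)).
- by exists C => _ [n _ <-]; apply: hC.
Qed.

Lemma abs_summable_tsum u : abs_summable u -> series u @ \oo --> tsum u.
Proof. by move=> /abs_summable_cvg. Qed.

Lemma tsumE u s : series u @ \oo --> s -> tsum u = s.
Proof. by move=> /cvg_lim; apply. Qed.

Lemma ge0_abs_summable u : (forall k, 0 <= u k) -> cvgn (series u) ->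
  abs_summable u.
Proof.
move=> u0 cu; exists (tsum u) => n.
under eq_bigr do rewrite ger0_norm //.
apply: (@nondecreasing_cvgn_le R (series u)) => //.
by move=> m k mk; apply: ler_sum_widen.
Qed.

Lemma bounded_abs_summable u C : (forall k, 0 <= u k) ->
  (forall n, \sum_(0 <= k < n) u k <= C) -> abs_summable u.
Proof.
by move=> u0 h; exists C => n; under eq_bigr do rewrite ger0_norm //.
Qed.

Lemma abs_summable_le u v (M : R) : abs_summable v ->
  (forall k, `|u k| <= M * `|v k|) -> abs_summable u.
Proof.
move=> [C hC] h; exists (`|M| * C) => n.
apply: (@le_trans _ _ (\sum_(0 <= k < n) `|M| * `|v k|)).
  apply: ler_sum => k _; apply: (le_trans (h k)).
  by apply: ler_wpM2r => //; apply: ler_norm.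
by rewrite -mulr_sumr ler_wpM2l.
Qed.

Lemma abs_summable_norm u : abs_summable u -> abs_summable (fun k => `|u k|).
Proof.
by move=> su; apply: (@abs_summable_le _ u 1) => // k; rewrite normr_id mul1r.
Qed.

Lemma abs_summableD u v : abs_summable u -> abs_summable v ->
  abs_summable (fun k => u k + v k).
Proof.
move=> [C hC] [D hD]; exists (C + D) => n.
apply: le_trans (lerD (hC n) (hD n)); rewrite -big_split /=.
by apply: ler_sum => k _; apply: ler_normD.
Qed.

Lemma abs_summableZ u a : abs_summable u -> abs_summable (fun k => a * u k).
Proof. by move=> su; apply: (@abs_summable_le _ u `|a|) => // k; rewrite normrM. Qed.

Lemma abs_summable_mulr u (phi : nat -> R) C : abs_summable u ->
  (forall k, `|phi k| <= C) -> abs_summable (fun k => u k * phi k).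
Proof.
move=> su h; apply: (@abs_summable_le _ u C) => // k.
by rewrite normrM mulrC ler_wpM2r.
Qed.

Lemma tsumD u v : abs_summable u -> abs_summable v ->
  tsum (fun k => u k + v k) = tsum u + tsum v.
Proof.
move=> su sv; apply: tsumE.
have -> : series (fun k => u k + v k) = series u \+ series v.
  by apply/funext => n; rewrite /series /= big_split.
by apply: cvgD; apply: abs_summable_tsum.
Qed.

Lemma tsumZ u a : abs_summable u -> tsum (fun k => a * u k) = a * tsum u.
Proof.
move=> su; apply: tsumE.
have -> : series (fun k => a * u k) = (fun n => a * series u n).
  by apply/funext => n; rewrite /series /= mulr_sumr.
by apply: cvgMr; apply: abs_summable_tsum.
Qed.

Lemma abs_summableB u v : abs_summable u -> abs_summable v ->
  abs_summable (fun k => u k - v k).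
Proof.
move=> su sv.
have -> : (fun k => u k - v k) = (fun k => u k + (-1) * v k).
  by apply/funext => k; rewrite mulN1r.
by apply: abs_summableD => //; apply: abs_summableZ.
Qed.

Lemma tsumB u v : abs_summable u -> abs_summable v ->
  tsum (fun k => u k - v k) = tsum u - tsum v.
Proof.
move=> su sv.
have -> : (fun k => u k - v k) = (fun k => u k + (-1) * v k).
  by apply/funext => k; rewrite mulN1r.
by rewrite tsumD ?tsumZ ?mulN1r //; apply: abs_summableZ.
Qed.

Lemma abs_summable0 : abs_summable (fun=> 0).
Proof. by exists 0 => n; rewrite big1 // => k _; rewrite normr0. Qed.

Lemma tsum0 : tsum (fun=> 0) = 0.
Proof.
apply: tsumE; have -> : series (fun=> 0 : R) = fun=> 0.
  by apply/funext => n; rewrite /series /= big1.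
exact: cvg_cst.
Qed.

Lemma abs_summable_sum (f : nat -> nat -> R) m n :
  (forall i, (m <= i < n)%N -> abs_summable (f i)) ->
  abs_summable (fun k => \sum_(m <= i < n) f i k).
Proof.
elim: n => [|n IH] sf.
  have -> : (fun k => \sum_(m <= i < 0) f i k) = fun=> 0.
    by apply/funext => k; rewrite big_geq.
  exact: abs_summable0.
have [mn|nm] := leqP m n; last first.
  have -> : (fun k => \sum_(m <= i < n.+1) f i k) = fun=> 0.
    by apply/funext => k; rewrite big_geq.
  exact: abs_summable0.
have -> : (fun k => \sum_(m <= i < n.+1) f i k) =
    (fun k => \sum_(m <= i < n) f i k + f n k).
  by apply/funext => k; rewrite big_nat_recr.
apply: abs_summableD; last by apply: sf; rewrite mn leqnn.
by apply: IH => i /andP[mi ni]; apply: sf; rewrite mi ltnW.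
Qed.

Lemma tsum_sum (f : nat -> nat -> R) m n :
  (forall i, (m <= i < n)%N -> abs_summable (f i)) ->
  tsum (fun k => \sum_(m <= i < n) f i k) = \sum_(m <= i < n) tsum (f i).
Proof.
elim: n => [|n IH] sf.
  rewrite big_geq //.
  have -> : (fun k => \sum_(m <= i < 0) f i k) = fun=> 0.
    by apply/funext => k; rewrite big_geq.
  exact: tsum0.
have [mn|nm] := leqP m n; last first.
  rewrite big_geq //.
  have -> : (fun k => \sum_(m <= i < n.+1) f i k) = fun=> 0.
    by apply/funext => k; rewrite big_geq.
  exact: tsum0.
have sf' i : (m <= i < n)%N -> abs_summable (f i).
  by move=> /andP[mi ni]; apply: sf; rewrite mi ltnW.
have -> : (fun k => \sum_(m <= i < n.+1) f i k) =
    (fun k => \sum_(m <= i < n) f i k + f n k).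
  by apply/funext => k; rewrite big_nat_recr.
rewrite tsumD ?IH // ?big_nat_recr //.
- exact: abs_summable_sum.
- by apply: sf; rewrite mn leqnn.
Qed.

Lemma tsum_le u v : abs_summable u -> abs_summable v ->
  (forall k, u k <= v k) -> tsum u <= tsum v.
Proof. by move=> su sv; apply: lim_series_le; apply: abs_summable_cvg. Qed.

Lemma tsum_ge0 u : abs_summable u -> (forall k, 0 <= u k) -> 0 <= tsum u.
Proof. by move=> su u0; rewrite -tsum0 tsum_le //; apply: abs_summable0. Qed.

Lemma tsum_norm_le u : abs_summable u -> `|tsum u| <= tsum (fun k => `|u k|).
Proof.
by move=> su; apply: lim_series_norm; apply/abs_summable_cvg/abs_summable_norm.
Qed.

Lemma psum_le_tsum u n : (forall k, 0 <= u k) -> abs_summable u ->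
  \sum_(0 <= k < n) u k <= tsum u.
Proof.
move=> u0 /abs_summable_cvg cu; apply: (@nondecreasing_cvgn_le R (series u)) => //.
by move=> m k mk; apply: ler_sum_widen.
Qed.

Lemma tsum_le_bound u C : abs_summable u ->
  (forall n, \sum_(0 <= k < n) u k <= C) -> tsum u <= C.
Proof.
move=> /abs_summable_cvg cu h; apply: limr_le => //.
by apply: nearW.
Qed.

Lemma finite_abs_summable u N : (forall k, (N <= k)%N -> u k = 0) ->
  abs_summable u.
Proof.
move=> h; exists (\sum_(0 <= k < N) `|u k|) => n.
have [nN|/ltnW Nn] := leqP n N; first by apply: ler_sum_widen.
rewrite (big_cat_nat (leq0n _) Nn) //= gerDl.
rewrite [X in X <= _](_ : _ = 0) //.
by rewrite big_nat big1 // => k /andP[Nk _]; rewrite h // normr0.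
Qed.

Lemma tsum_finite u N : (forall k, (N <= k)%N -> u k = 0) ->
  tsum u = \sum_(0 <= k < N) u k.
Proof.
move=> h; apply: tsumE; apply/cvgnP => e e0; exists N => n Nn.
rewrite /series /= (big_cat_nat (leq0n _) Nn) //= addrC addrK.
rewrite [X in `|X|](_ : _ = 0) ?normr0 ?ltW //.
by rewrite big_nat big1 // => k /andP[Nk _]; rewrite h.
Qed.

Lemma psum_tsum_tail u N : abs_summable u ->
  tsum u = \sum_(0 <= k < N) u k + tsum (fun k => if (k < N)%N then 0 else u k).
Proof.
move=> su; pose v k := if (k < N)%N then u k else 0.
have hv k : (N <= k)%N -> v k = 0 by rewrite /v ltnNge => ->.
have st : abs_summable (fun k => if (k < N)%N then 0 else u k).
  by apply: (@abs_summable_le _ u 1) => // k; case: ifP; rewrite ?normr0 mul1r.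
have -> : \sum_(0 <= k < N) u k = tsum v.
  rewrite (tsum_finite hv) big_nat [RHS]big_nat; apply: eq_bigr => k.
  by rewrite /v => /andP[_ ->].
rewrite -tsumD //; last exact: (finite_abs_summable hv).
by congr tsum; apply/funext => k; rewrite /v; case: ifP; rewrite ?addr0 ?add0r.
Qed.

Lemma tsum_tail_le u N e : (forall M, \sum_(N <= k < M) `|u k| <= e) ->
  abs_summable u -> `|tsum u - \sum_(0 <= k < N) u k| <= e.
Proof.
move=> h su; rewrite (psum_tsum_tail N su) addrC addKr.
have st : abs_summable (fun k => if (k < N)%N then 0 else u k).
  by apply: (@abs_summable_le _ u 1) => // k; case: ifP; rewrite ?normr0 mul1r.
apply: (le_trans (tsum_norm_le st)); apply: tsum_le_bound.
  exact: abs_summable_norm.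
move=> n; apply: le_trans (h n).
have [nN|/ltnW Nn] := leqP n N.
  rewrite (big_geq nN) big_nat big1 // => k /andP[_ kn].
  by rewrite (leq_trans kn nN) normr0.
rewrite (big_cat_nat (leq0n _) Nn) //=.
have -> : \sum_(0 <= k < N) `|if (k < N)%N then 0 else u k| = 0.
  by rewrite big_nat big1 // => k /andP[_ ->]; rewrite normr0.
rewrite add0r !big_nat; apply: ler_sum => k /andP[Nk _].
by rewrite ltnNge Nk.
Qed.

Lemma abs_summable_tail u e : abs_summable u -> 0 < e ->
  exists N, forall M, \sum_(N <= k < M) `|u k| <= e.
Proof.
move=> /abs_summable_norm su e0.
have /cvgnP/(_ _ e0)[N hN] := abs_summable_tsum su; exists N => M.
have [NM|/ltnW MN] := leqP N M; last by rewrite big_geq // ltW.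
have := hN N (leqnn _); rewrite distrC => /(le_trans (ler_norm _)).
apply: le_trans; rewrite lerBrDl /series /= -(big_cat_nat (leq0n _) NM) //=.
exact: psum_le_tsum.
Qed.

Lemma cvgn_sum (f : nat -> nat -> R) (g : nat -> R) m n :
  (forall k, f ^~ k @ \oo --> g k) ->
  \sum_(m <= k < n) f i k @[i --> \oo] --> \sum_(m <= k < n) g k.
Proof.
move=> fg; elim: n => [|n IH].
  have -> : (fun i => \sum_(m <= k < 0) f i k) = fun=> 0.
    by apply/funext => i; rewrite big_geq.
  by rewrite big_geq //; exact: cvg_cst.
have [mn|nm] := leqP m n.
  have -> : (fun i => \sum_(m <= k < n.+1) f i k) =
      (fun i => \sum_(m <= k < n) f i k + f i n).
    by apply/funext => i; rewrite big_nat_recr.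
  by rewrite big_nat_recr //; exact: cvgD.
have -> : (fun i => \sum_(m <= k < n.+1) f i k) = fun=> 0.
  by apply/funext => i; rewrite big_geq.
by rewrite big_geq //; exact: cvg_cst.
Qed.

(* Tannery's theorem with uniformly small tails instead of a majorant, so that
   it also covers weakly convergent sequences of measures on nat. *)
Lemma tannery (f : nat -> nat -> R) (g : nat -> R) :
  (forall n, abs_summable (f n)) -> (forall k, f n k @[n --> \oo] --> g k) ->
  (forall e, 0 < e -> exists N, exists n0, forall n M, (n0 <= n)%N ->
     \sum_(N <= k < M) `|f n k| <= e) ->
  abs_summable g /\ tsum (f n) @[n --> \oo] --> tsum g.
Proof.
move=> sf fg tl.
(* The bound on a block from N to M passes to [g] as n grows with M fixed, since the block is a
   finite sum. *)
have tg e : 0 < e -> exists N, exists n0,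
    (forall n M, (n0 <= n)%N -> \sum_(N <= k < M) `|f n k| <= e) /\
    (forall M, \sum_(N <= k < M) `|g k| <= e).
  move=> /tl[N [n0 h]]; exists N, n0; split=> // M.
  have c : \sum_(N <= k < M) `|f n k| @[n --> \oo] --> \sum_(N <= k < M) `|g k|.
    by apply: (@cvgn_sum (fun n k => `|f n k|)) => k; apply: cvg_norm; apply: fg.
  rewrite -(cvg_lim _ c) //; apply: limr_le; first by apply/cvg_ex; eexists; apply: c.
  by exists n0 => // n /= nn; apply: h.
have sg : abs_summable g.
  have [N [n0 [_ h]]] := tg 1 ltr01.
  exists (\sum_(0 <= k < N) `|g k| + 1) => n.
  have [nN|/ltnW Nn] := leqP n N.
    by apply: (le_trans (ler_sum_widen _ nN)) => //; rewrite lerDl.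
  by rewrite (big_cat_nat (leq0n _) Nn) //= lerD2l.
split=> //; apply/cvgnP => e e0.
have e3 : 0 < e / 3 by rewrite divr_gt0.
have [N [n0 [hf hg]]] := tg _ e3.
have c : \sum_(0 <= k < N) f n k @[n --> \oo] --> \sum_(0 <= k < N) g k.
  exact: cvgn_sum.
have /cvgnP/(_ _ e3)[n1 h1] := c.
exists (maxn n0 n1) => n; rewrite geq_max => /andP[nn0 nn1].
have H1 := h1 n nn1.
have H2 := tsum_tail_le (hf n ^~ nn0) (sf n).
have H3 := tsum_tail_le hg sg.
move: H1 H2 H3; rewrite !ler_distl => /andP[? ?] /andP[? ?] /andP[? ?].
apply/andP; split; lra.
Qed.

Lemma tannery_dominated (f : nat -> nat -> R) (g D : nat -> R) :
  abs_summable D -> (forall n k, `|f n k| <= `|D k|) ->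
  (forall k, f n k @[n --> \oo] --> g k) ->
  abs_summable g /\ tsum (f n) @[n --> \oo] --> tsum g.
Proof.
move=> sD fD fg; apply: tannery => //.
  by move=> n; apply: (@abs_summable_le _ D 1) => // k; rewrite mul1r.
move=> e e0; have [N hN] := abs_summable_tail sD e0.
exists N, 0%N => n M _; apply: le_trans (hN M).
by apply: ler_sum.
Qed.

Definition conv u v : nat -> R := fun k => \sum_(0 <= i < k.+1) u i * v (k - i)%N.

Lemma psum_conv u v n : \sum_(0 <= k < n) conv u v k =
  \sum_(0 <= i < n) u i * \sum_(0 <= j < n - i) v j.
Proof.
elim: n => [|n IH]; first by rewrite !big_geq.
rewrite big_nat_recr //= IH /conv [in LHS]big_nat_recr //= addrA.
rewrite [RHS]big_nat_recr //= subnn subSnn big_nat1; congr (_ + _).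
rewrite -big_split /= !big_nat; apply: eq_bigr => i /andP[_ ni].
by rewrite subSn ?(ltnW ni) // big_nat_recr //= mulrDr.
Qed.

(* The partial sums of the Cauchy product are sum_(i < n) u i * V (n - i) with
   V the partial sums of v, to which dominated convergence applies. *)
Lemma tsum_conv u v : abs_summable u -> abs_summable v ->
  abs_summable (conv u v) /\ tsum (conv u v) = tsum u * tsum v.
Proof.
move=> su sv; have [C hC] := su; have [D hD] := sv.
have C0 : 0 <= C by apply: le_trans (hC 0%N); rewrite big_geq.
have D0 : 0 <= D by apply: le_trans (hD 0%N); rewrite big_geq.
split.
  exists (C * D) => n.
  apply: (@le_trans _ _ (\sum_(0 <= k < n)
      conv (fun k => `|u k|) (fun k => `|v k|) k)).
    apply: ler_sum => k _; apply: (le_trans (ler_norm_sum _ _ _)).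
    by apply: ler_sum => i _; rewrite normrM.
  rewrite psum_conv; apply: (@le_trans _ _ (\sum_(0 <= i < n) `|u i| * D)).
    by apply: ler_sum => i _; apply: ler_wpM2l.
  by rewrite -mulr_suml ler_wpM2r.
pose f n k := if (k < n)%N then u k * series v (n - k)%N else 0.
have -> : tsum u * tsum v = tsum (fun k => u k * tsum v).
  by rewrite mulrC -tsumZ //; congr tsum; apply/funext => k; rewrite mulrC.
apply: tsumE.
have -> : series (conv u v) = (fun n => tsum (f n)).
  apply/funext => n; rewrite (@tsum_finite _ n); last first.
    by move=> k; rewrite /f leqNgt => /negbTE ->.
  rewrite /series /= psum_conv !big_nat; apply: eq_bigr => i /andP[_ ni].
  by rewrite /f ni.
have := @tannery_dominated f (fun k => u k * tsum v) (fun k => u k * D).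
case=> //.
- exact: (@abs_summable_mulr _ (fun=> D) `|D|).
- move=> n k; rewrite /f; case: ifP => _; last by rewrite normr0.
  rewrite !normrM ler_wpM2l // [leRHS]ger0_norm //.
  exact: le_trans (ler_norm_sum _ _ _) (hD _).
- move=> k.
  have c : u k * series v n @[n --> \oo] --> u k * tsum v.
    by apply: cvgMr; apply: abs_summable_tsum.
  apply/cvgnP => e e0; have /cvgnP/(_ _ e0)[N hN] := c.
  exists (N + k).+1 => n hn; rewrite /f.
  have -> : (k < n)%N by apply: leq_trans hn; rewrite ltnS leq_addl.
  by apply: hN; rewrite leq_subRL ?(leq_trans _ hn) //; lia.
Qed.

End RealSeries.

(** * Binomial thinning and Toeplitz summation *)

Section Thinning.
Context (R : realType).
Implicit Types (r : R) (a : nat -> R).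

Definition binom_weight r v j : R := 'C(v, j)%:R * r ^+ j * (1 - r) ^+ (v - j).

(** The law of the number of survivors among a random number of individuals with law [a], each
    surviving independently with probability [r]. *)
Definition thin r a : nat -> R := fun j => tsum (fun v => a v * binom_weight r v j).

(** The factorial moment of order [i]; it is meaningful only where the series is known to be
    summable. *)
Definition moment a i : R := tsum (fun v => a v * (v ^_ i)%:R).

Lemma binom_weight_ge0 r v j : 0 <= r <= 1 -> 0 <= binom_weight r v j.
Proof.
move=> /andP[r0 r1]; rewrite /binom_weight !mulr_ge0 ?exprn_ge0 //.
by rewrite subr_ge0.
Qed.

Lemma binom_weight_small r v j : (v < j)%N -> binom_weight r v j = 0.
Proof. by move=> vj; rewrite /binom_weight bin_small // !mul0r. Qed.

Lemma sum_binom_weight r v J : (v < J)%N ->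
  \sum_(0 <= j < J) binom_weight r v j = 1.
Proof.
move=> vJ; rewrite (big_cat_nat (leq0n _) vJ) /=.
rewrite [X in _ + X](_ : _ = 0) ?addr0; last first.
  by rewrite big_nat big1 // => j /andP[vj _]; rewrite binom_weight_small.
rewrite big_mkord -(expr1n R v) -[in RHS](subrK r 1) exprDn.
by apply: eq_bigr => j _; rewrite /binom_weight -[RHS]mulr_natl; ring.
Qed.

Lemma psum_binom_weight_le1 r v J : 0 <= r <= 1 ->
  \sum_(0 <= j < J) binom_weight r v j <= 1.
Proof.
move=> r01; rewrite -(@sum_binom_weight r v (maxn J v.+1)) ?leq_maxr //.
apply: ler_sum_widen; last exact: leq_maxl.
by move=> k; apply: binom_weight_ge0.
Qed.

Lemma binom_weight_le1 r v j : 0 <= r <= 1 -> binom_weight r v j <= 1.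
Proof.
move=> r01; apply: le_trans (psum_binom_weight_le1 v j.+1 r01).
rewrite big_nat_recr //= lerDr sumr_ge0 // => i _; exact: binom_weight_ge0.
Qed.

(** The identity (j+1) C(v+1,j+1) = (v+1) C(v,j) pulls out the factor r (v+1) and leaves a partial
    sum of binomial weights, at most 1. *)
Lemma binom_weight_mean r v J : 0 <= r <= 1 ->
  \sum_(0 <= j < J) binom_weight r v j * j%:R <= r * v%:R.
Proof.
move=> r01; have /andP[r0 r1] := r01.
case: J => [|J]; first by rewrite big_geq // mulr_ge0.
rewrite big_nat_recl // mulr0 add0r.
case: v => [|v].
  by rewrite big1 ?mulr0 // => j _; rewrite binom_weight_small // mul0r.
apply: (@le_trans _ _ (\sum_(0 <= j < J) r * v.+1%:R * binom_weight r v j)).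
  apply: ler_sum => j _; rewrite le_eqVlt; apply/orP; left; apply/eqP.
  have h := mul_bin_diag v.+1 j; rewrite /= in h.
  have : v.+1%:R * 'C(v, j)%:R = j.+1%:R * 'C(v.+1, j.+1)%:R :> R.
    by rewrite -!natrM h.
  rewrite /binom_weight subSS exprS => e.
  transitivity (r * r ^+ j * (1 - r) ^+ (v - j) * (j.+1%:R * 'C(v.+1, j.+1)%:R)).
    by ring.
  by rewrite -e; ring.
rewrite -mulr_sumr -[leRHS]mulr1 ler_wpM2l ?mulr_ge0 //.
exact: psum_binom_weight_le1.
Qed.

(** By Pascal's rule the signed remainder for n+1 and I+1 is the one for n and I+1 plus r times the
    one for n and I, so nonnegativity propagates by induction on n. *)
Lemma bonferroni r n I : 0 <= r <= 1 ->
  0 <= (-1) ^+ I * (\sum_(0 <= i < I.+1) (- r) ^+ i * 'C(n, i)%:R - (1 - r) ^+ n).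
Proof.
move=> /andP[r0 r1]; elim: n I => [|n IH] I.
  rewrite big_nat_recl // big1 ?addr0; last by move=> i _; rewrite bin0n mulr0.
  by rewrite !expr0 bin0 mulr1 subrr mulr0.
case: I => [|I].
  rewrite big_nat1 !expr0 !mul1r subr_ge0 bin0; apply: exprn_ile1; lra.
have H1 := IH I.+1; have H2 := mulr_ge0 r0 (IH I).
have -> : \sum_(0 <= i < I.+2) (- r) ^+ i * 'C(n.+1, i)%:R =
    \sum_(0 <= i < I.+2) (- r) ^+ i * 'C(n, i)%:R -
    r * \sum_(0 <= i < I.+1) (- r) ^+ i * 'C(n, i)%:R :> R.
  rewrite big_nat_recl // [in RHS]big_nat_recl // !bin0 -addrA; congr (_ + _).
  rewrite mulr_sumr -sumrB; apply: eq_bigr => i _.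
  by rewrite binS natrD exprS; ring.
apply: le_trans (addr_ge0 H1 H2) _; rewrite le_eqVlt; apply/orP; left.
by apply/eqP; rewrite !exprS; ring.
Qed.

(** Separates the choice of j survivors from the choice of i among the remaining v - j individuals,
    as inclusion-exclusion requires. *)
Lemma ffact_split v j i :
  (v ^_ (j + i))%:R = 'C(v, j)%:R * j`!%:R * ('C(v - j, i)%:R * i`!%:R) :> R.
Proof.
rewrite -!natrM !bin_ffact; congr _%:R.
by elim: j v => [|j IH] v; [rewrite ffactn0 mul1n subn0|
  case: v => [|v]; rewrite ?ffact0n ?mul0n // addSn !ffactSS IH subSS mulnA].
Qed.

Variables (r : R) (a : nat -> R).
Hypotheses (r01 : 0 <= r <= 1) (a0 : forall v, 0 <= a v) (sa : abs_summable a).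

Lemma abs_summable_thin_term j :
  abs_summable (fun v => a v * binom_weight r v j).
Proof.
apply: (@abs_summable_mulr _ _ _ 1) => // v.
by rewrite ger0_norm ?binom_weight_le1 ?binom_weight_ge0.
Qed.

Lemma thin_ge0 j : 0 <= thin r a j.
Proof.
rewrite /thin; apply: tsum_ge0 => [|v]; first exact: abs_summable_thin_term.
by rewrite mulr_ge0 ?binom_weight_ge0.
Qed.

Lemma psum_thin (phi : nat -> R) J :
  \sum_(0 <= j < J) thin r a j * phi j =
  tsum (fun v => a v * \sum_(0 <= j < J) binom_weight r v j * phi j).
Proof.
transitivity (tsum (fun v =>
    \sum_(0 <= j < J) phi j * (a v * binom_weight r v j))).
  rewrite tsum_sum; last by move=> j _; apply/abs_summableZ/abs_summable_thin_term.
  apply: eq_bigr => j _.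
  by rewrite mulrC tsumZ //; apply: abs_summable_thin_term.
congr tsum; apply/funext => v; rewrite mulr_sumr.
by apply: eq_bigr => j _; ring.
Qed.

(** An exchange of two infinite sums by dominated convergence: the inner partial sums are bounded by
    C because the binomial weights sum to at most 1, and for fixed v they are constant in J once J >
    v. *)
Lemma thin_series_cvg (phi : nat -> R) C : (forall j, `|phi j| <= C) ->
  series (fun j => thin r a j * phi j) @ \oo -->
  tsum (fun v => a v * \sum_(0 <= j < v.+1) binom_weight r v j * phi j).
Proof.
move=> hC.
have -> : series (fun j => thin r a j * phi j) = (fun J =>
    tsum (fun v => a v * \sum_(0 <= j < J) binom_weight r v j * phi j)).
  by apply/funext => J; rewrite -psum_thin.
have C0 : 0 <= C by apply: le_trans (hC 0%N).
have [] // := @tannery_dominated R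
  (fun J v => a v * \sum_(0 <= j < J) binom_weight r v j * phi j)
  (fun v => a v * \sum_(0 <= j < v.+1) binom_weight r v j * phi j)
  (fun v => C * a v).
- exact: abs_summableZ.
- move=> J v; rewrite !normrM mulrC ler_wpM2r // (ger0_norm C0).
  apply: (le_trans (ler_norm_sum _ _ _)).
  apply: (@le_trans _ _ (\sum_(0 <= j < J) C * binom_weight r v j)).
    apply: ler_sum => j _; rewrite normrM mulrC.
    by rewrite (ger0_norm (binom_weight_ge0 _ _ r01)) ler_wpM2r ?binom_weight_ge0.
  by rewrite -mulr_sumr -[leRHS]mulr1 ler_wpM2l // psum_binom_weight_le1.
- move=> v; apply: cvg_near_cst; exists v.+1 => // J /= vJ.
  congr (_ * _).
  rewrite (big_cat_nat (leq0n _) vJ) /=.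
  rewrite [X in _ + X](_ : _ = 0) ?addr0 //.
  rewrite big_nat big1 // => j /andP[vj _].
  by rewrite binom_weight_small // mul0r.
Qed.

Lemma abs_summable_thin : abs_summable (thin r a).
Proof.
apply: ge0_abs_summable => [j|]; first exact: thin_ge0.
have := @thin_series_cvg (fun=> 1) 1; rewrite normr1 => /(_ (fun=> lexx _)).
have -> : (fun j => thin r a j * 1) = thin r a.
  by apply/funext => j; rewrite mulr1.
by move=> c; apply/cvg_ex; eexists; exact: c.
Qed.

Lemma tsum_thin (phi : nat -> R) C : (forall j, `|phi j| <= C) ->
  tsum (fun j => thin r a j * phi j) =
  tsum (fun v => a v * \sum_(0 <= j < v.+1) binom_weight r v j * phi j).
Proof. by move=> hC; apply: tsumE; apply: thin_series_cvg hC. Qed.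

Lemma thin_total : tsum (thin r a) = tsum a.
Proof.
have := @tsum_thin (fun=> 1) 1; rewrite normr1 => /(_ (fun=> lexx _)).
have -> : (fun j => thin r a j * 1) = thin r a.
  by apply/funext => j; rewrite mulr1.
move=> ->; congr tsum; apply/funext => v.
under eq_bigr do rewrite mulr1.
by rewrite sum_binom_weight // mulr1.
Qed.

Lemma thin_mean_le J : abs_summable (fun v => a v * v%:R) ->
  \sum_(0 <= j < J) thin r a j * j%:R <= r * moment a 1.
Proof.
move=> sm; have sm' := abs_summableZ r sm; have /andP[r0 r1] := r01.
have -> : r * moment a 1 = tsum (fun v => r * (a v * v%:R)).
  rewrite tsumZ // /moment; congr (_ * tsum _); apply/funext => v.
  by rewrite ffactn1.
have h0 v : 0 <= \sum_(0 <= j < J) binom_weight r v j * j%:R.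
  by rewrite sumr_ge0 // => j _; rewrite mulr_ge0 ?binom_weight_ge0.
have h v : a v * \sum_(0 <= j < J) binom_weight r v j * j%:R <= r * (a v * v%:R).
  rewrite mulrCA; apply: ler_wpM2l => //; exact: binom_weight_mean.
rewrite psum_thin; apply: tsum_le => //.
apply: (@abs_summable_le _ _ _ 1 sm') => v.
by rewrite mul1r !ger0_norm ?mulr_ge0.
Qed.

(** Exactly j survivors among v means that the v - j others die; [bonferroni] expands the factor (1
    - r)^(v - j), and averaging over v turns the products of binomial coefficients into factorial
    moments. *)
Lemma thin_bonferroni j I :
  (forall i, (i <= I)%N -> abs_summable (fun v => a v * (v ^_ (j + i))%:R)) ->
  0 <= (-1) ^+ I * (\sum_(0 <= i < I.+1)
    (-1) ^+ i / (j`!%:R * i`!%:R) * (r ^+ (j + i) * moment a (j + i)) - thin r a j).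
Proof.
move=> sm; have /andP[r0 r1] := r01.
pose f i v := (-1) ^+ i / (j`!%:R * i`!%:R) * r ^+ (j + i) * (a v * (v ^_ (j + i))%:R).
have sf i : (0 <= i < I.+1)%N -> abs_summable (f i).
  by move=> /andP[_ iI]; apply: abs_summableZ; apply: sm.
have -> : \sum_(0 <= i < I.+1) (-1) ^+ i / (j`!%:R * i`!%:R) *
    (r ^+ (j + i) * moment a (j + i)) = tsum (fun v => \sum_(0 <= i < I.+1) f i v).
  rewrite tsum_sum // !big_nat; apply: eq_bigr => i iI.
  by rewrite tsumZ ?mulrA //; apply: sm; case/andP: iI.
have sF := abs_summable_sum sf; have sT := abs_summable_thin_term j.
rewrite -tsumB // -tsumZ; last exact: abs_summableB.
apply: tsum_ge0; first by apply/abs_summableZ/abs_summableB.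
move=> v.
have -> : \sum_(0 <= i < I.+1) f i v =
    a v * 'C(v, j)%:R * r ^+ j * \sum_(0 <= i < I.+1) (- r) ^+ i * 'C(v - j, i)%:R.
  rewrite mulr_sumr; apply: eq_bigr => i _; rewrite /f ffact_split (exprNn r) (exprD r).
  have j0 : j`!%:R != 0 :> R by rewrite pnatr_eq0 -lt0n fact_gt0.
  have i0 : i`!%:R != 0 :> R by rewrite pnatr_eq0 -lt0n fact_gt0.
  by field; rewrite ?i0 ?j0.
have H := mulr_ge0 (mulr_ge0 (mulr_ge0 (a0 v) (ler0n R 'C(v, j))) (exprn_ge0 j r0))
  (@bonferroni r (v - j) I r01).
apply: le_trans H _; rewrite le_eqVlt; apply/orP; left; apply/eqP.
by rewrite /binom_weight; ring.
Qed.

End Thinning.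

Section Toeplitz.
Context (R : realType).

(** [S n.+1] is a convex combination of [S n] and c/(1 - q) with weights q and 1 - q. Once c/(1 - q)
    is close to [lam], the remaining error of [S] is multiplied by q at each step, and the product
    of the q tends to 0. *)
Lemma toeplitz (S q c : nat -> R) K (lam : R) :
  (forall n, (K <= n)%N -> S n.+1 = q n.+1 * S n + c n.+1) ->
  (forall n, 0 <= q n.+1 < 1) ->
  (forall N, \prod_(N <= k < n) q k.+1 @[n --> \oo] --> 0) ->
  c n.+1 / (1 - q n.+1) @[n --> \oo] --> lam ->
  S n @[n --> \oo] --> lam.
Proof.
move=> rec q01 q0 hc; apply/cvgnP => e e0.
have e2 : 0 < e / 2 by rewrite divr_gt0.
move/cvgnP/(_ _ e2): hc => [N0 hN0]; pose N := maxn K N0.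
have KN : (K <= N)%N by rewrite leq_maxl.
have NN : (N0 <= N)%N by rewrite leq_maxr.
have H m : `|S (N + m)%N - lam| <=
    e / 2 + `|S N - lam| * \prod_(N <= k < N + m) q k.+1.
  elim: m => [|m IH]; first by rewrite addn0 big_geq // mulr1 lerDr ltW.
  have Nm : (N <= N + m)%N by rewrite leq_addr.
  rewrite addnS rec ?(leq_trans KN) // big_nat_recr //=.
  have /andP[h0 h1] := q01 (N + m)%N.
  have := hN0 (N + m)%N (leq_trans NN Nm).
  set Q := q _; set A := S (N + m)%N; set B := c _ => h.
  have d1 : 0 < 1 - q (N + m).+1 by rewrite subr_gt0.
  have -> : Q * A + B - lam = Q * (A - lam) + (1 - Q) * (B / (1 - Q) - lam).
    by rewrite /Q /B; field; rewrite gt_eqF.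
  apply: (le_trans (ler_normD _ _)); rewrite !normrM (ger0_norm h0) (gtr0_norm d1).
  have := ler_wpM2l h0 IH; have := ler_wpM2l (ltW d1) h.
  rewrite -/A -/Q; set P := \prod_(_ <= _ < _) _ => ? ?.
  have -> : `|S N - lam| * (P * Q) = Q * (`|S N - lam| * P) by ring.
  by nra.
have hp : `|S N - lam| * \prod_(N <= k < n) q k.+1 @[n --> \oo] --> 0.
  by rewrite -[X in _ --> X](mulr0 `|S N - lam|); apply: cvgMr.
move/cvgnP/(_ _ e2): hp => [N1 hN1].
exists (maxn N N1) => n; rewrite geq_max => /andP[nN nN1].
have := H (n - N)%N; rewrite subnKC // => h; apply: (le_trans h).
have := hN1 n nN1; rewrite subr0 => /(le_trans (ler_norm _)); lra.
Qed.

Variable rho : nat -> R.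
Hypotheses (rho01 : forall n, (0 < n)%N -> 0 <= rho n < 1)
  (rho_lim : rho n @[n --> \oo] --> (1 : R))
  (rho_sum : (\sum_(1 <= n <oo) (1 - rho n)%:E = +oo)%E).

(** The probability that an individual alive at time k is still alive at time n, for k <= n. *)
Definition tail_prod k n : R := \prod_(k <= l < n) rho l.+1.

Lemma tail_prod01 k n : 0 <= tail_prod k n <= 1.
Proof.
apply: (big_ind (fun x : R => 0 <= x <= 1)) => [|x y /andP[? ?] /andP[? ?]|l _].
- by rewrite ler01 lexx.
- by rewrite mulr_ge0 // mulr_ile1.
- by have /andP[-> /ltW ->] := rho01 (ltn0Sn l).
Qed.

Lemma tail_prod_ge0 k n : 0 <= tail_prod k n.
Proof. by case/andP: (tail_prod01 k n). Qed.

Lemma tail_prod_le1 k n : tail_prod k n <= 1.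
Proof. by case/andP: (tail_prod01 k n). Qed.

Lemma tail_prodS k n : (k <= n)%N -> tail_prod k n.+1 = tail_prod k n * rho n.+1.
Proof. by move=> kn; rewrite /tail_prod big_nat_recr. Qed.

Lemma tail_prodnn n : tail_prod n n = 1.
Proof. by rewrite /tail_prod big_geq. Qed.

Lemma rho_sum_unbounded (A : R) : exists N, A < \sum_(0 <= k < N) (1 - rho k.+1).
Proof.
apply: contrapT => /forallNP h.
suff : (\sum_(1 <= n <oo) (1 - rho n)%:E <= A%:E)%E by rewrite rho_sum leye_eq.
apply: lime_le.
  apply: is_cvg_nneseries => n n1 _; rewrite lee_fin subr_ge0.
  by case/andP: (rho01 n1) => _ /ltW.
apply: nearW => n; rewrite sumEFin lee_fin.
case: n => [|n].
  by rewrite big_geq //; have /negP := h 0%N; rewrite big_geq // -leNgt.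
rewrite big_add1 /= leNgt; apply/negP; exact: h.
Qed.

(** From rho <= exp(-(1 - rho)) the product is at most exp of minus a partial sum of a divergent
    series. *)
Lemma tail_prod_cvg0 k : tail_prod k n @[n --> \oo] --> (0 : R).
Proof.
have bound n : (k <= n)%N ->
    tail_prod k n <= expR (- \sum_(k <= l < n) (1 - rho l.+1)).
  elim: n => [|n IH] kn.
    rewrite /tail_prod !big_geq ?oppr0 ?expR0 //.
  have [->|kn'] := eqVneq k n.+1.
    by rewrite /tail_prod !big_geq // oppr0 expR0.
  have kn1 : (k <= n)%N by rewrite -ltnS ltn_neqAle kn'.
  rewrite tail_prodS // big_nat_recr //= opprD expRD; apply: ler_pM.
  - exact: tail_prod_ge0.
  - by case/andP: (rho01 (ltn0Sn n)).
  - exact: IH.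
  - by have := expR_ge1Dx (- (1 - rho n.+1)); rewrite opprB addrCA subrr addr0.
apply/cvgnP => e e0.
(* The added 1/e suffices because exp s >= 1 + s > 1/e for s > 1/e; the finite sum up to k makes up
   for starting at k. *)
have [N hN] := rho_sum_unbounded (\sum_(0 <= l < k) (1 - rho l.+1) + e^-1).
have r0 l : 0 <= 1 - rho l.+1.
  by rewrite subr_ge0; case/andP: (rho01 (ltn0Sn l)) => _ /ltW.
exists (maxn k N) => n; rewrite geq_max => /andP[kn Nn].
rewrite subr0 (ger0_norm (tail_prod_ge0 _ _)); apply: (le_trans (bound n kn)).
have := lt_le_trans hN (ler_sum_widen r0 Nn).
rewrite (big_cat_nat (leq0n _) kn) /= ltrD2l => h.
rewrite expRN -[leRHS]invrK lef_pV2 ?posrE ?expR_gt0 ?invr_gt0 //.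
apply: ltW (lt_le_trans h _); apply: le_trans (expR_ge1Dx _).
by rewrite lerDr.
Qed.

(** Toeplitz summation with factor rho^i. The geometric sum (1 - rho^i)/(1 - rho) tends to i and so
    accounts for the i in the denominator. The limit does not depend on K, as every fixed term
    fades. *)
Lemma weighted_sum_cvg (c : nat -> R) i K (lam : R) : (0 < i)%N ->
  c n.+1 / (i%:R * (1 - rho n.+1)) @[n --> \oo] --> lam ->
  \sum_(K <= k < n) c k.+1 * tail_prod k.+1 n ^+ i @[n --> \oo] --> lam.
Proof.
move=> i0 hc; apply: (@toeplitz _ (fun n => rho n ^+ i) c K).
- move=> n Kn; rewrite big_nat_recr //= tail_prodnn expr1n mulr1; congr (_ + _).
  rewrite mulr_sumr !big_nat; apply: eq_bigr => k /andP[_ kn].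
  by rewrite tail_prodS // exprMn; ring.
- move=> n; have /andP[h0 h1] := rho01 (ltn0Sn n).
  by rewrite exprn_ge0 // exprn_ilt1 // -lt0n.
- case: i i0 {hc} => // i _ N; apply/cvgnP => e e0.
  have /cvgnP/(_ _ e0)[M hM] := @tail_prod_cvg0 N.
  exists M => n nM; rewrite prodrXl subr0 normrX.
  apply: le_trans (hM n nM); rewrite subr0 exprS.
  rewrite (ger0_norm (tail_prod_ge0 _ _)) -[leRHS]mulr1 ler_wpM2l ?tail_prod_ge0 //.
  by apply: exprn_ile1; rewrite ?tail_prod_ge0 ?tail_prod_le1.
- have c1 : \sum_(0 <= j < i) rho n.+1 ^+ j @[n --> \oo] --> (i%:R : R).
    have -> : i%:R = \sum_(0 <= j < i) (1 ^+ j) :> R.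
      by under eq_bigr do rewrite expr1n; rewrite sumr_const_nat subn0.
    apply: cvgn_sum => j.
    have : rho n.+1 @[n --> \oo] --> (1 : R) by move: rho_lim; rewrite -(@cvg_shiftS R^o).
    by elim: j => [|j IH] h; [exact: cvg_cst|];
      under eq_fun do rewrite exprS; rewrite exprS; apply: cvgM => //; apply: IH.
  have iR : i%:R != 0 :> R by rewrite pnatr_eq0 -lt0n.
  have -> : lam = lam * i%:R / i%:R by rewrite mulfK.
  have cc := cvgM (cvgM hc (cvg_cst (i%:R : R))) (cvgV iR c1).
  suff -> : (fun n => c n.+1 / (1 - rho n.+1 ^+ i)) =
      (fun n => c n.+1 / (i%:R * (1 - rho n.+1)) * i%:R /
        \sum_(0 <= j < i) rho n.+1 ^+ j) by exact: cc.
  apply/funext => n.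
  have d : 1 - rho n.+1 != 0.
    by rewrite subr_eq0 eq_sym lt_eqF //; case/andP: (rho01 (ltn0Sn n)).
  have -> : 1 - rho n.+1 ^+ i = (1 - rho n.+1) * \sum_(0 <= j < i) rho n.+1 ^+ j.
    by rewrite -opprB subrX1 -mulNr opprB big_mkord.
  rewrite (invfM (1 - _)); move: ((\sum_(_ <= _ < _) _)^-1) => t.
  by field; rewrite ?d ?iR.
Qed.

End Toeplitz.

(** * Complex generating functions *)

Section Trigonometry.
Context (R : realType).
Implicit Types x y : R.

Lemma norm_sin_le y : `|sin y| <= `|y|.
Proof.
wlog y0 : y / 0 <= y.
  move=> h; have [/h//|/ltW] := leP 0 y.
  by rewrite -oppr_ge0 => /h; rewrite sinN !normrN.
have [c _] := @MVT_segment R sin cos 0 y y0 (fun x _ => is_derive_sin x)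
  (continuous_subspaceT (@continuous_sin R)).
rewrite sin0 !subr0 => ->; rewrite normrM ler_piMl //.
by rewrite ler_norml cos_geN1 cos_le1.
Qed.

Lemma cos_half y : 1 - cos y = 2 * sin (y / 2) ^+ 2.
Proof.
have -> : cos y = cos ((y / 2) *+ 2) by rewrite -mulr_natr divfK.
by rewrite cos_mulr2n cos2sin2; ring.
Qed.

Lemma one_sub_cos_le_sqr y : 1 - cos y <= y ^+ 2.
Proof.
rewrite cos_half; have := norm_sin_le (y / 2).
rewrite -(@ler_pXn2r _ 2) ?nnegrE // !real_normK ?num_real // => h.
by nra.
Qed.

Lemma one_sub_cos_le_norm y : 1 - cos y <= `|y|.
Proof.
rewrite cos_half; have := norm_sin_le (y / 2).
have : `|sin (y / 2)| <= 1 by rewrite ler_norml sin_geN1 sin_le1.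
rewrite normrM (@ger0_norm _ 2^-1) // -(real_normK (num_real (sin _))).
have := normr_ge0 (sin (y / 2)); have := normr_ge0 y; nra.
Qed.

(** The mean value theorem gives (cos c - 1) y with 0 <= c <= y, and 1 - cos c <= c. A quadratic
    error is all that the comparison of products uses. *)
Lemma sin_sub_le y : `|sin y - y| <= y ^+ 2.
Proof.
wlog y0 : y / 0 <= y.
  move=> h; have [/h//|/ltW] := leP 0 y.
  by rewrite -oppr_ge0 => /h; rewrite sinN sqrrN -opprD normrN.
have dF x : x \in `]0, y[ -> is_derive x 1 (fun t => sin t - t) (cos x - 1).
  by move=> _; apply: is_deriveB.
have cF : {within `[0, y], continuous (fun t : R => sin t - t)}.
  apply: continuous_subspaceT => x; apply: cvgB; [exact: continuous_sin|exact: cvg_id].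
have [c] := MVT_segment y0 dF cF.
rewrite in_itv /= sin0 !subr0 => /andP[c0 cy] ->.
rewrite normrM (ger0_norm y0) expr2 ler_wpM2r // distrC ger0_norm; last first.
  by rewrite subr_ge0 cos_le1.
by apply: le_trans (one_sub_cos_le_norm c) _; rewrite ger0_norm.
Qed.

(** The upper bound comes from exp(-x) >= 1 - x: then exp x <= 1/(1 - x), which exceeds 1 + x by
    x^2/(1 - x). *)
Lemma expR_sub_le x : x <= 0 -> 0 <= expR x - 1 - x <= x ^+ 2.
Proof.
move=> x0; apply/andP; split; first by have := expR_ge1Dx x; lra.
have h := expR_ge1Dx (- x); have := expRxMexpNx_1 x.
have := expR_gt0 x; have := expR_le1 x; nra.
Qed.

End Trigonometry.

Section ComplexGeneratingFunction.
Context (R : realType).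
Implicit Types (z w : R[i]) (a b : nat -> R).
Local Open Scope complex_scope.
Local Notation Re := complex.Re.
Local Notation Im := complex.Im.

Lemma ReD z w : Re (z + w) = Re z + Re w. Proof. by case: z; case: w. Qed.
Lemma ImD z w : Im (z + w) = Im z + Im w. Proof. by case: z; case: w. Qed.
Lemma ReB z w : Re (z - w) = Re z - Re w. Proof. by case: z; case: w. Qed.
Lemma ImB z w : Im (z - w) = Im z - Im w. Proof. by case: z; case: w. Qed.
Lemma ReM z w : Re (z * w) = Re z * Re w - Im z * Im w.
Proof. by case: z; case: w. Qed.
Lemma ImM z w : Im (z * w) = Re z * Im w + Im z * Re w.
Proof. by case: z; case: w. Qed.
Lemma ReZ (r : R) z : Re (r%:C * z) = r * Re z.
Proof. by rewrite ReM /= mul0r subr0. Qed.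
Lemma ImZ (r : R) z : Im (r%:C * z) = r * Im z.
Proof. by rewrite ImM /= mul0r addr0. Qed.

Lemma Re_sum (f : nat -> R[i]) m n :
  Re (\sum_(m <= k < n) f k) = \sum_(m <= k < n) Re (f k).
Proof. by apply: (big_morph _ ReD). Qed.

Lemma Im_sum (f : nat -> R[i]) m n :
  Im (\sum_(m <= k < n) f k) = \sum_(m <= k < n) Im (f k).
Proof. by apply: (big_morph _ ImD). Qed.

Lemma complex_eqP z w : Re z = Re w -> Im z = Im w -> z = w.
Proof. by case: z => x y; case: w => x' y' /= -> ->. Qed.

Lemma norm_complex_le z (r s : R) : `|Re z| <= r -> `|Im z| <= s ->
  `|z| <= (r + s)%:C.
Proof.
move=> hr hs; have r0 := le_trans (normr_ge0 _) hr.
have s0 := le_trans (normr_ge0 _) hs.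
rewrite normc_def lecR -[r + s]ger0_norm ?addr_ge0 // -sqrtr_sqr ler_wsqrtr //.
rewrite -(real_normK (num_real (Re z))) -(real_normK (num_real (Im z))).
by have := normr_ge0 (Re z); have := normr_ge0 (Im z); nra.
Qed.

Lemma norm_Re_le z (r : R) : `|z| <= r%:C -> `|Re z| <= r.
Proof. by move=> h; rewrite -lecR; apply: le_trans (normc_ge_Re z) h. Qed.

Lemma norm_Im_le z (r : R) : `|z| <= r%:C -> `|Im z| <= r.
Proof.
move=> h; have := @norm_Re_le ('i%C * z) r; rewrite ReM /= mul0r mul1r sub0r normrN.
by apply; rewrite normrM normc_def /= expr0n expr1n add0r sqrtr1 mul1r.
Qed.

Lemma norm_le1_sqr z : `|z| <= 1 -> Re z ^+ 2 + Im z ^+ 2 <= 1.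
Proof.
rewrite normc_def (_ : 1 = 1%:C) // lecR => h.
have e0 : 0 <= Re z ^+ 2 + Im z ^+ 2 by rewrite addr_ge0 ?sqr_ge0.
by rewrite -(sqr_sqrtr e0); apply: exprn_ile1 => //; apply: sqrtr_ge0.
Qed.

Lemma norm_Re_exp z k : `|z| <= 1 -> `|Re (z ^+ k)| <= 1.
Proof. by move=> z1; apply: norm_Re_le; rewrite normrX exprn_ile1. Qed.

Lemma norm_Im_exp z k : `|z| <= 1 -> `|Im (z ^+ k)| <= 1.
Proof. by move=> z1; apply: norm_Im_le; rewrite normrX exprn_ile1. Qed.

Lemma cvg_complex (u : nat -> R[i]) z :
  Re (u n) @[n --> \oo] --> Re z -> Im (u n) @[n --> \oo] --> Im z ->
  (u : nat -> R[i]^o) @ \oo --> (z : R[i]^o).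
Proof.
move=> /cvgnP hr /cvgnP hi; apply/cvgrPdist_le => -[e e'] /=.
(* A positive element of [R[i]] has zero imaginary part, so the tolerance is real. *)
rewrite ltcE /= => /andP[/eqP -> e0].
have e2 : 0 < e / 2 by rewrite divr_gt0.
have [N hN] := hr _ e2; have [M hM] := hi _ e2.
exists (maxn N M) => // n /=; rewrite geq_max => /andP[/hN h1 /hM h2].
rewrite distrC [e]splitr; apply: norm_complex_le; rewrite ?ReB ?ImB //.
Qed.

(** A pair of real series, so that the theory of [tsum] applies to each component; [gf_series]
    identifies it with the complex power series. *)
Definition gf a z : R[i] :=
  tsum (fun k => a k * Re (z ^+ k)) +i* tsum (fun k => a k * Im (z ^+ k)).

Lemma abs_summable_Re a z : abs_summable a -> `|z| <= 1 ->
  abs_summable (fun k => a k * Re (z ^+ k)).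
Proof.
by move=> sa z1; apply: (abs_summable_mulr sa (C := 1)) => k; apply: norm_Re_exp.
Qed.

Lemma abs_summable_Im a z : abs_summable a -> `|z| <= 1 ->
  abs_summable (fun k => a k * Im (z ^+ k)).
Proof.
by move=> sa z1; apply: (abs_summable_mulr sa (C := 1)) => k; apply: norm_Im_exp.
Qed.

Lemma gf_series a z : abs_summable a -> `|z| <= 1 ->
  series (fun k => (a k)%:C * z ^+ k : R[i]^o) @ \oo --> (gf a z : R[i]^o).
Proof.
move=> sa z1; apply: cvg_complex.
- under eq_fun do rewrite /series /= Re_sum.
  under eq_fun do under eq_bigr do rewrite ReZ.
  exact: (abs_summable_tsum (abs_summable_Re sa z1)).
- under eq_fun do rewrite /series /= Im_sum.
  under eq_fun do under eq_bigr do rewrite ImZ.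
  exact: (abs_summable_tsum (abs_summable_Im sa z1)).
Qed.

Lemma gf_conv a b z : abs_summable a -> abs_summable b -> `|z| <= 1 ->
  gf (conv a b) z = gf a z * gf b z.
Proof.
move=> sa sb z1.
have aR := abs_summable_Re sa z1; have aI := abs_summable_Im sa z1.
have bR := abs_summable_Re sb z1; have bI := abs_summable_Im sb z1.
have [sRR RR] := tsum_conv aR bR; have [sII II] := tsum_conv aI bI.
have [sRI RI] := tsum_conv aR bI; have [sIR IR] := tsum_conv aI bR.
apply: complex_eqP; rewrite ?ReM ?ImM /=.
- rewrite -RR -II -tsumB //; congr tsum; apply/funext => k.
  rewrite /conv mulr_suml -sumrB !big_nat; apply: eq_bigr => i /andP[_ ik].
  have -> : z ^+ k = z ^+ i * z ^+ (k - i) by rewrite -exprD subnKC.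
  by rewrite ReM; ring.
- rewrite -RI -IR -tsumD //; congr tsum; apply/funext => k.
  rewrite /conv mulr_suml -big_split !big_nat; apply: eq_bigr => i /andP[_ ik].
  have -> : z ^+ k = z ^+ i * z ^+ (k - i) by rewrite -exprD subnKC.
  by rewrite /= ImM; ring.
Qed.

Lemma norm_convex_comb (r : R) z : 0 <= r <= 1 -> `|z| <= 1 ->
  `|(1 - r)%:C + r%:C * z| <= 1.
Proof.
move=> /andP[r0 r1] z1; apply: (le_trans (ler_normD _ _)).
have e (s : R) : 0 <= s -> `|s%:C| = s%:C by move=> s0; rewrite ger0_norm ?ler0c.
rewrite normrM !e ?subr_ge0 //.
have -> : 1 = (1 - r)%:C + r%:C * 1 by apply: complex_eqP => /=; ring.
by rewrite lerD2l ler_wpM2l ?ler0c.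
Qed.

Lemma sum_binom_weight_exp (r : R) v z :
  \sum_(0 <= j < v.+1) (binom_weight r v j)%:C * z ^+ j =
  ((1 - r)%:C + r%:C * z) ^+ v.
Proof.
rewrite exprDn big_mkord; apply: eq_bigr => j _.
by rewrite /binom_weight !rmorphM !rmorphXn /= rmorph_nat -[RHS]mulr_natl exprMn; ring.
Qed.

Lemma gf_thin (r : R) a z : 0 <= r <= 1 -> (forall v, 0 <= a v) ->
  abs_summable a -> `|z| <= 1 ->
  gf (thin r a) z = gf a ((1 - r)%:C + r%:C * z).
Proof.
move=> r01 a0 sa z1; apply: complex_eqP => /=.
- rewrite (tsum_thin r01 sa (phi := fun k => Re (z ^+ k)) (C := 1)); last first.
    by move=> k; apply: norm_Re_exp.
  congr tsum; apply/funext => v; rewrite -sum_binom_weight_exp Re_sum.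
  by congr (_ * _); apply: eq_bigr => j _; rewrite ReZ.
- rewrite (tsum_thin r01 sa (phi := fun k => Im (z ^+ k)) (C := 1)); last first.
    by move=> k; apply: norm_Im_exp.
  congr tsum; apply/funext => v; rewrite -sum_binom_weight_exp Im_sum.
  by congr (_ * _); apply: eq_bigr => j _; rewrite ImZ.
Qed.

(* With w = gf a z, |w|^2 is the a-average of Re (conj w * z^k) <= |w|. *)
Lemma norm_gf_le1 a z : (forall k, 0 <= a k) -> abs_summable a ->
  tsum a <= 1 -> `|z| <= 1 -> `|gf a z| <= 1.
Proof.
move=> a0 sa a1 z1; rewrite normc_def (_ : 1 = 1%:C) // lecR.
set x := Re _; set y := Im _; set s := Num.sqrt _.
have e0 : 0 <= x ^+ 2 + y ^+ 2 by rewrite addr_ge0 ?sqr_ge0.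
have s0 : 0 <= s by apply: sqrtr_ge0.
have s2 : s ^+ 2 = x ^+ 2 + y ^+ 2 by rewrite sqr_sqrtr.
have aR := abs_summable_Re sa z1; have aI := abs_summable_Im sa z1.
have : s ^+ 2 <= s.
  have -> : s ^+ 2 = tsum (fun k => x * (a k * Re (z ^+ k)) + y * (a k * Im (z ^+ k))).
    by rewrite tsumD ?tsumZ //; try exact: abs_summableZ; rewrite s2 !expr2.
  apply: (@le_trans _ _ (tsum (fun k => s * a k))); last first.
    by rewrite tsumZ // -[leRHS]mulr1 ler_wpM2l.
  apply: tsum_le => [||k]; first by apply: abs_summableD; apply: abs_summableZ.
    exact: abs_summableZ.
  have := norm_le1_sqr (_ : `|z ^+ k| <= 1); rewrite normrX exprn_ile1 // => /(_ isT).
  set c := Re _; set d := Im _ => cd.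
  (* Cauchy-Schwarz for (x, y) and (c, d), with the square of x d - y c as the defect in Lagrange's
     identity. *)
  have h : x * c + y * d <= s.
    have [|xy0] := leP (x * c + y * d) 0; first by move/le_trans; apply.
    rewrite -(@ler_pXn2r _ 2) ?nnegrE ?(ltW xy0) // s2.
    by have := sqr_ge0 (x * d - y * c); nra.
  by have := ler_wpM2l (a0 k) h; nra.
have [//|s1] := leP s 1; nra.
Qed.

Section SmallMass.
Variables (a : nat -> R) (z : R[i]).
Hypotheses (a0 : forall k, 0 <= a k) (sa : abs_summable a) (a1 : tsum a = 1)
  (z1 : `|z| <= 1).

Lemma abs_summable_gf_sub1 :
  abs_summable (fun k => a k * Re (z ^+ k - 1)) /\
  abs_summable (fun k => a k * Im (z ^+ k - 1)).
Proof.
split.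
- apply: (abs_summable_mulr sa (C := 2)) => k; rewrite ReB /=.
  by have := norm_Re_exp k z1; rewrite !ler_norml; lra.
- apply: (abs_summable_mulr sa (C := 1)) => k; rewrite ImB /= subr0.
  exact: norm_Im_exp.
Qed.

Lemma gf_sub1E : gf a z - 1 =
  tsum (fun k => a k * Re (z ^+ k - 1)) +i* tsum (fun k => a k * Im (z ^+ k - 1)).
Proof.
have aR := abs_summable_Re sa z1; have aI := abs_summable_Im sa z1.
apply: complex_eqP; rewrite ?ReB ?ImB /=.
- rewrite -[X in _ - X]a1 -tsumB //; congr tsum; apply/funext => k.
  by rewrite ReB /= mulrBr mulr1.
- by rewrite subr0; congr tsum; apply/funext => k; rewrite ImB /= subr0.
Qed.

(** Keeps [cexp (gf a z - 1)] in the unit disc, as [dist_prod_le] demands, and makes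
    [cexp_first_order] applicable. *)
Lemma Re_gf_sub1_le0 : Re (gf a z - 1) <= 0.
Proof.
rewrite gf_sub1E /= -(tsum0 R); apply: tsum_le.
- by case: abs_summable_gf_sub1.
- exact: abs_summable0.
- move=> k; rewrite ReB /= -[leRHS](mulr0 (a k)) ler_wpM2l // subr_le0.
  by have := norm_Re_exp k z1; rewrite ler_norml => /andP[].
Qed.

(** The summand at k = 0 vanishes, so only the mass 1 - [a 0] off 0 contributes, with a factor of
    modulus at most 2. *)
Lemma norm_gf_sub1_le :
  `|Re (gf a z - 1)| <= 2 * (1 - a 0%N) /\ `|Im (gf a z - 1)| <= 2 * (1 - a 0%N).
Proof.
have [sR sI] := abs_summable_gf_sub1.
pose b k := if (k < 1)%N then 0 else a k.
have sb : abs_summable b.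
  by apply: (@abs_summable_le _ _ a 1) => // k; rewrite /b; case: ifP;
     rewrite ?normr0 ?mul1r.
have -> : 2 * (1 - a 0%N) = tsum (fun k => 2 * b k).
  have := a1; rewrite (psum_tsum_tail 1 sa) big_nat1 -/b => h.
  by rewrite tsumZ // -h addrAC subrr add0r.
rewrite gf_sub1E /=; split.
- apply: (le_trans (tsum_norm_le sR)); apply: tsum_le => [||k].
  + exact: abs_summable_norm.
  + exact: abs_summableZ.
  + rewrite normrM (ger0_norm (a0 k)) mulrC /b; case: ifP => [|_].
      by rewrite ltnS leqn0 => /eqP ->; rewrite expr0 subrr /= normr0 mul0r mulr0.
    apply: ler_wpM2r => //; rewrite ReB /=.
    by have := norm_Re_exp k z1; rewrite !ler_norml; lra.
- apply: (le_trans (tsum_norm_le sI)); apply: tsum_le => [||k].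
  + exact: abs_summable_norm.
  + exact: abs_summableZ.
  + rewrite normrM (ger0_norm (a0 k)) mulrC /b; case: ifP => [|_].
      by rewrite ltnS leqn0 => /eqP ->; rewrite expr0 subrr /= normr0 mul0r mulr0.
    apply: ler_wpM2r => //; rewrite ImB /= subr0.
    by have := norm_Im_exp k z1; rewrite !ler_norml; lra.
Qed.

End SmallMass.

Lemma cexpD z w : cexp (z + w) = cexp z * cexp w.
Proof.
rewrite /cexp ReD ImD expRD cosD sinD.
by apply: complex_eqP; rewrite !(ReM, ImM) /=; ring.
Qed.

Lemma cexp0 : cexp (0 : R[i]) = 1.
Proof. by rewrite /cexp /= expR0 cos0 sin0 mul1r. Qed.

Lemma cexp_sum (f : nat -> R[i]) m n :
  cexp (\sum_(m <= k < n) f k) = \prod_(m <= k < n) cexp (f k).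
Proof. by apply: (big_morph _ cexpD cexp0). Qed.

Lemma norm_cexp z : `|cexp z| = (expR (Re z))%:C.
Proof.
rewrite /cexp normrM normc_def [X in _ * X]normc_def /=.
rewrite cos2Dsin2 sqrtr1 mulr1 expr0n addr0 sqrtr_sqr.
by rewrite ger0_norm // expR_ge0.
Qed.

Lemma cexp_first_order z : Re z <= 0 ->
  `|1 + z - cexp z| <= (3 * (Re z ^+ 2 + Im z ^+ 2))%:C.
Proof.
case: z => x y /= x0.
(* The real part of the error takes one share of x^2 + y^2 and the imaginary part two. *)
have -> : 3 * (x ^+ 2 + y ^+ 2) = (x ^+ 2 + y ^+ 2) + 2 * (x ^+ 2 + y ^+ 2) by ring.
have /andP[e1 e2] := expR_sub_le x0.
have e3 : expR x <= 1 by rewrite expR_le1.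
have e4 := expR_gt0 x.
have c1 := one_sub_cos_le_sqr y; have c2 := cos_le1 y.
have := sin_sub_le y; rewrite ler_norml => /andP[s1 s2].
have s3 := norm_sin_le y; have s4 := normr_ge0 y.
apply: norm_complex_le; rewrite ?ReB ?ImB ?ReD ?ImD /cexp ?ReM ?ImM /=.
- have -> : 1 + x - (expR x * cos y - 0 * sin y) =
    - (expR x - 1 - x) + expR x * (1 - cos y) by ring.
  by rewrite ler_norml; apply/andP; split; nra.
- have -> : 0 + y - (expR x * sin y + 0 * cos y) =
    - (sin y - y) + (1 - expR x) * sin y by ring.
  have h : `|(1 - expR x) * sin y| <= x ^+ 2 + y ^+ 2.
    rewrite normrM ger0_norm ?subr_ge0 //.
    apply: (@le_trans _ _ (`|x| * `|y|)).
      apply: ler_pM; rewrite ?subr_ge0 // ler0_norm //; lra.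
    rewrite -(real_normK (num_real x)) -(real_normK (num_real y)).
    by have := normr_ge0 x; nra.
  apply: (le_trans (ler_normD _ _)); rewrite normrN.
  have : `|sin y - y| <= y ^+ 2 by rewrite ler_norml s1.
  by have := sqr_ge0 x; lra.
Qed.

Lemma cvg_cexp (u : nat -> R[i]) z :
  Re (u n) @[n --> \oo] --> Re z -> Im (u n) @[n --> \oo] --> Im z ->
  Re (cexp (u n)) @[n --> \oo] --> Re (cexp z) /\
  Im (cexp (u n)) @[n --> \oo] --> Im (cexp z).
Proof.
move=> hr hi; rewrite /cexp; split.
- under eq_fun do rewrite ReM /= mul0r subr0.
  rewrite ReM /= mul0r subr0; apply: cvgM.
    exact: (cvg_comp _ _ hr (@continuous_expR R _)).
  exact: (cvg_comp _ _ hi (@continuous_cos R _)).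
- under eq_fun do rewrite ImM /= mul0r addr0.
  rewrite ImM /= mul0r addr0; apply: cvgM.
    exact: (cvg_comp _ _ hr (@continuous_expR R _)).
  exact: (cvg_comp _ _ hi (@continuous_sin R _)).
Qed.

(** Telescoping: factors are exchanged one at a time while all the others have modulus at most 1. *)
Lemma dist_prod_le (x y : nat -> R[i]) m n :
  (forall k, `|x k| <= 1) -> (forall k, `|y k| <= 1) ->
  `|\prod_(m <= k < n) x k - \prod_(m <= k < n) y k| <=
    \sum_(m <= k < n) `|x k - y k|.
Proof.
move=> hx hy; elim: n => [|n IH]; first by rewrite !big_geq // subrr normr0.
have [mn|nm] := leqP m n; last by rewrite !big_geq // subrr normr0.
rewrite !big_nat_recr //=; set X := \prod_(_ <= _ < _) x _.
set Y := \prod_(_ <= _ < _) y _.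
have -> : X * x n - Y * y n = (X - Y) * x n + Y * (x n - y n) by ring.
apply: (le_trans (ler_normD _ _)); rewrite !normrM; apply: lerD.
  by apply: le_trans IH; rewrite -[leRHS]mulr1 ler_wpM2l.
rewrite -[leRHS]mul1r ler_wpM2r // /Y.
by apply: (big_ind (fun w : R[i] => `|w| <= 1)) => //;
  [rewrite normr1|move=> u v hu hv; rewrite normrM mulr_ile1].
Qed.

End ComplexGeneratingFunction.

(** * Convergence of coefficients *)

Section Coefficients.
Context (R : realType).
Implicit Types (a b : nat -> R).

Definition pmf a := [/\ forall k, 0 <= a k, abs_summable a & tsum a = 1].

Lemma pmf_le1 a k : pmf a -> a k <= 1.
Proof.
move=> [a0 sa <-]; apply: le_trans (psum_le_tsum k.+1 a0 sa).
by rewrite big_nat_recr //= lerDr sumr_ge0.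
Qed.

Lemma pmf_thin (r : R) a : 0 <= r <= 1 -> pmf a -> pmf (thin r a).
Proof.
move=> r01 [a0 sa a1]; split.
- by move=> k; apply: thin_ge0.
- exact: abs_summable_thin.
- by rewrite thin_total.
Qed.

Lemma pmf_conv a b : pmf a -> pmf b -> pmf (conv a b).
Proof.
move=> [a0 sa a1] [b0 sb b1]; have [sc c] := tsum_conv sa sb; split=> //.
- by move=> k; apply: sumr_ge0 => i _; rewrite mulr_ge0.
- by rewrite c a1 b1 mulr1.
Qed.

Lemma abs_summable_exp a (x : R) : abs_summable a -> 0 <= x <= 1 ->
  abs_summable (fun k => a k * x ^+ k).
Proof.
move=> sa /andP[x0 x1]; apply: (abs_summable_mulr sa (C := 1)) => k.
by rewrite ger0_norm ?exprn_ge0 // exprn_ile1.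
Qed.

(** Isolates the k-th term of the difference of two power series. The later terms carry the factor
    x^(k+1) and total mass at most 2, so after division by x^k they are small with x. *)
Lemma coefficient_dist a b k (x : R) : pmf a -> pmf b -> 0 <= x <= 1 ->
  `|a k - b k| * x ^+ k <=
  `|tsum (fun i => a i * x ^+ i) - tsum (fun i => b i * x ^+ i)| +
  \sum_(0 <= i < k) `|a i - b i| + 2 * x ^+ k.+1.
Proof.
move=> [a0 sa a1] [b0 sb b1] x01; have /andP[x0 x1] := x01.
pose d i := (a i - b i) * x ^+ i.
have sd : abs_summable d by apply: abs_summable_exp => //; apply: abs_summableB.
have sax := abs_summable_exp sa x01; have sbx := abs_summable_exp sb x01.
rewrite -tsumB // (_ : (fun i => _) = d); last first.
  by apply/funext => i; rewrite /d mulrBl.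
have xk i : 0 <= x ^+ i by rewrite exprn_ge0.
have tl M : \sum_(k.+1 <= i < M) `|d i| <= 2 * x ^+ k.+1.
  apply: (@le_trans _ _ (x ^+ k.+1 * \sum_(k.+1 <= i < M) (a i + b i))).
    rewrite mulr_sumr !big_nat; apply: ler_sum => i /andP[ki _].
    rewrite normrM mulrC ger0_norm //; apply: ler_pM => //.
      by rewrite -(subnK ki) exprD ler_piMl // exprn_ile1.
    by rewrite ler_norml; have := a0 i; have := b0 i; lra.
  rewrite mulrC ler_wpM2r //.
  have ab0 i : 0 <= a i + b i by rewrite addr_ge0.
  apply: (@le_trans _ _ (\sum_(0 <= i < maxn k.+1 M) (a i + b i))).
    have [kM|Mk] := leqP k.+1 M; last by rewrite big_geq ?sumr_ge0 // ltnW.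
    by rewrite (big_cat_nat (leq0n _) kM) /= lerDr sumr_ge0.
  apply: (le_trans (psum_le_tsum _ ab0 (abs_summableD sa sb))).
  by rewrite tsumD // a1 b1.
have := tsum_tail_le tl sd; rewrite big_nat_recr //=.
have h : `|\sum_(0 <= i < k) d i| <= \sum_(0 <= i < k) `|a i - b i|.
  apply: (le_trans (ler_norm_sum _ _ _)); apply: ler_sum => i _.
  by rewrite normrM (ger0_norm (xk i)) ler_piMr // exprn_ile1.
have -> : `|a k - b k| * x ^+ k = `|d k| by rewrite normrM (ger0_norm (xk k)).
move: h; set D := tsum d; set S := \sum_(_ <= _ < _) d _.
set S' := \sum_(_ <= _ < _) _ => h1 h2.
have -> : d k = D - S - (D - (S + d k)) by ring.
apply: (le_trans (ler_normB _ _)); apply: lerD => //.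
by apply: (le_trans (ler_normB _ _)); rewrite lerD2l.
Qed.

Lemma cauchy_cvgn (u : nat -> R) :
  (forall e, 0 < e -> exists N, forall n m, (N <= n)%N -> (N <= m)%N ->
     `|u n - u m| <= e) -> cvgn u.
Proof.
move=> h; apply: cauchy_cvg; apply: cauchy_exP => e e0.
have e2 : 0 < e / 2 by rewrite divr_gt0.
have [N hN] := h _ e2; exists (u N); exists N => // n /= Nn.
rewrite /ball /=; apply: le_lt_trans (hN N n (leqnn N) Nn) _.
by rewrite ltr_pdivrMr // ltr_pMr // ltr1n.
Qed.

(** [G] is not known to be a power series, so there is no candidate limit; strong induction on k
    shows instead that the k-th coefficients form a Cauchy sequence. *)
Lemma cvg_coefficients (p : nat -> nat -> R) (G : R -> R) :
  (forall n, pmf (p n)) ->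
  (forall x, 0 < x < 1 -> tsum (fun i => p n i * x ^+ i) @[n --> \oo] --> G x) ->
  forall k, cvgn (fun n => p n k).
Proof.
move=> hp hG; elim/ltn_ind => k IH; apply: cauchy_cvgn => e e0.
(* With x <= e/4 the tail 2 x^(k+1) takes half of e x^k, and each of the two other terms takes d, a
   quarter; the 1/2 keeps x below 1. *)
pose x := Num.min 2^-1 (e / 4).
have x0 : 0 < x by rewrite lt_min invr_gt0 ltr0n divr_gt0.
have x1 : x < 1 by rewrite gt_min invf_lt1 ?ltr0n // ltr1n.
have xe : x <= e / 4 by rewrite ge_min lexx orbT.
pose d := e / 4 * x ^+ k.
have d0 : 0 < d by rewrite mulr_gt0 ?divr_gt0 // exprn_gt0.
pose P n := \sum_(0 <= i < k) `|p n i - limn (fun n => p n i)|.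
have hP : P n @[n --> \oo] --> 0.
  have -> : 0 = \sum_(0 <= i < k) 0 :> R by rewrite big1.
  have : forall m, (m <= k)%N -> \sum_(0 <= i < m)
      `|p n i - limn (fun n => p n i)| @[n --> \oo] --> \sum_(0 <= i < m) (0 : R).
    elim=> [|m IHm] mk.
      under eq_fun do rewrite big_geq //; rewrite big_geq //; exact: cvg_cst.
    under eq_fun do rewrite big_nat_recr //=.
    rewrite big_nat_recr //=; apply: cvgD; first exact/IHm/ltnW.
    rewrite -[X in _ --> X](normr0 R); apply: cvg_norm.
    rewrite -(subrr (limn (fun n => p n m))); apply: cvgB; last exact: cvg_cst.
    exact: IH.
  exact.
have d2 : 0 < d / 2 by rewrite divr_gt0.
have x01 : 0 < x < 1 by rewrite x0.
move/cvgnP/(_ _ d2): (hG x x01) => [N1 h1]; move/cvgnP/(_ _ d2): hP => [N2 h2].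
exists (maxn N1 N2) => n m; rewrite !geq_max => /andP[n1 n2] /andP[m1 m2].
have x01' : 0 <= x <= 1 by rewrite !ltW.
have H := coefficient_dist k (hp n) (hp m) x01'.
have xk : 0 < x ^+ k by rewrite exprn_gt0.
rewrite -(ler_pM2r xk); apply: (le_trans H).
have H1 : `|tsum (fun i => p n i * x ^+ i) - tsum (fun i => p m i * x ^+ i)| <= d.
  have := h1 n n1; have := h1 m m1; rewrite !ler_norml; lra.
have H2 : \sum_(0 <= i < k) `|p n i - p m i| <= d.
  apply: (@le_trans _ _ (P n + P m)).
    rewrite /P -big_split /=; apply: ler_sum => i _.
    by rewrite [X in _ <= _ + X]distrC; apply: ler_distD.
  have := h2 n n2; have := h2 m m2; rewrite !subr0 !ler_norml; lra.
rewrite exprS.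
have : 2 * (x * x ^+ k) <= 2 * d by rewrite ler_pM2l // /d ler_pM2r.
by rewrite /d in H1 H2 *; lra.
Qed.

(** Because [q] has total mass 1, some finite block carries nearly all of it, hence nearly all of
    [p n] for large n. This yields the uniformly small tails required by [tannery]. *)
Lemma scheffe (p : nat -> nat -> R) (q phi : nat -> R) C :
  (forall n, pmf (p n)) -> pmf q -> (forall k, p n k @[n --> \oo] --> q k) ->
  (forall k, `|phi k| <= C) ->
  tsum (fun k => p n k * phi k) @[n --> \oo] --> tsum (fun k => q k * phi k).
Proof.
move=> hp [q0 sq q1] pq hC.
have C0 : 0 <= C by apply: le_trans (hC 0%N).
have [] // := @tannery R (fun n k => p n k * phi k) (fun k => q k * phi k).
- by move=> n; have [_ sp _] := hp n; apply: abs_summable_mulr sp hC.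
- by move=> k; apply: cvgMl; apply: pq.
(* [C] may be 0, hence the added 1. *)
move=> e e0; pose d := e / (C + 1).
have C1 : 0 < C + 1 by rewrite ltr_wpDl.
have d0 : 0 < d by rewrite divr_gt0.
have d2 : 0 < d / 2 by rewrite divr_gt0.
have /cvgnP/(_ _ d2)[N hN] := abs_summable_tsum sq.
have c := @cvgn_sum R p q 0 N pq; move/cvgnP/(_ _ d2): c => [n0 h0].
exists N, n0 => n M /h0 H; have [p0 sp p1] := hp n.
have T : \sum_(N <= k < M) p n k <= d.
  have [NM|/ltnW MN] := leqP N M; last by rewrite big_geq // ltW.
  have := psum_le_tsum M p0 sp; rewrite (big_cat_nat (leq0n _) NM) /= p1.
  have := hN N (leqnn N); rewrite q1 /series /=.
  by move: H; rewrite !ler_norml; lra.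
apply: (@le_trans _ _ (\sum_(N <= k < M) p n k * C)).
  by apply: ler_sum => k _; rewrite normrM ger0_norm // ler_wpM2l.
rewrite -mulr_suml; apply: le_trans (ler_wpM2r C0 T) _.
by rewrite /d mulrAC ler_pdivrMr // ler_wpM2l ?lerDl // ltW.
Qed.

End Coefficients.

(** * Thinned immigration *)

Lemma cvgn_exp (R : realType) (u : nat -> R) (l : R) i :
  u n @[n --> \oo] --> l -> u n ^+ i @[n --> \oo] --> l ^+ i.
Proof.
move=> ul; have -> : (fun n => u n ^+ i) = (fun x => x ^+ i) \o u by [].
exact: (cvg_comp _ _ ul (@exprn_continuous _ i l)).
Qed.

Lemma cvgn_sum0 (R : realType) (f : nat -> nat -> R) m n :
  (forall k, f i k @[i --> \oo] --> (0 : R)) ->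
  \sum_(m <= k < n) f i k @[i --> \oo] --> (0 : R).
Proof. by move=> /(@cvgn_sum R f (fun=> 0) m n); rewrite big1_eq. Qed.

Lemma cvgn_add (R : realType) (u v : nat -> R) (l m : R) :
  u n @[n --> \oo] --> l -> v n @[n --> \oo] --> m ->
  u n + v n @[n --> \oo] --> l + m.
Proof. by move=> ul vm; apply: cvgD. Qed.

Lemma cvgn_sub (R : realType) (u v : nat -> R) (l m : R) :
  u n @[n --> \oo] --> l -> v n @[n --> \oo] --> m ->
  u n - v n @[n --> \oo] --> l - m.
Proof. by move=> ul vm; apply: cvgB. Qed.

Lemma cvgn_mul (R : realType) (u v : nat -> R) (l m : R) :
  u n @[n --> \oo] --> l -> v n @[n --> \oo] --> m ->
  u n * v n @[n --> \oo] --> l * m.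
Proof. by move=> ul vm; apply: cvgM. Qed.

Lemma eventually_eq_cvgn (R : realType) (u v : nat -> R) (l : R) N :
  u n @[n --> \oo] --> l -> (forall n, (N <= n)%N -> u n = v n) ->
  v n @[n --> \oo] --> l.
Proof.
move=> /cvgnP ul uv; apply/cvgnP => d d0; have [M hM] := ul d d0.
by exists (maxn N M) => n; rewrite geq_max => /andP[/uv <- /hM].
Qed.

Section ThinnedArray.
Context (R : realType).
Variables (rho : nat -> R) (e : nat -> nat -> R) (lam : nat -> R).
Hypotheses (rho01 : forall n, (0 < n)%N -> 0 <= rho n < 1)
  (rho_lim : rho n @[n --> \oo] --> (1 : R))
  (rho_sum : (\sum_(1 <= n <oo) (1 - rho n)%:E = +oo)%E)
  (e_pmf : forall n, pmf (e n))
  (e_moment : forall i, (0 < i)%N -> exists N, forall n, (N <= n)%N ->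
    abs_summable (fun v => e n v * (v ^_ i)%:R))
  (lam_lim : forall i, (0 < i)%N ->
    moment (e n.+1) i / (i%:R * (1 - rho n.+1)) @[n --> \oo] --> lam i)
  (lam_series : forall j, (0 < j)%N -> cvgn (series (intensity_term lam j))).

Let t k n := tail_prod rho k.+1 n.
Let t01 k n : 0 <= t k n <= 1. Proof. exact: tail_prod01. Qed.

(** Cohorts are counted from 0: cohort k immigrates at time k+1, and [t k n] is its survival
    probability from then to n. *)
Definition survivors k n : nat -> R := thin (t k n) (e k.+1).
Let a := survivors.

Lemma survivors_pmf k n : pmf (a k n).
Proof. exact: pmf_thin. Qed.

Let a_ge0 k n j : 0 <= a k n j. Proof. by have [] := survivors_pmf k n. Qed.
Let a_sum k n : abs_summable (a k n). Proof. by have [] := survivors_pmf k n. Qed.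

Lemma survivors_le j k n : (0 < j)%N -> a k n j <= 1 - a k n 0%N.
Proof.
case: j => // j _; have [a0 sa <-] := survivors_pmf k n.
rewrite lerBrDl; apply: le_trans (psum_le_tsum j.+2 a0 sa).
by rewrite big_nat_recr //= lerD2r big_nat_recl //= lerDl sumr_ge0.
Qed.

(** For a fixed cohort the survival probability tends to 0, and [e k.+1] itself is a summable
    majorant; this also covers cohorts with infinite moments. *)
Lemma survivors0_lim k : 1 - a k n 0%N @[n --> \oo] --> (0 : R).
Proof.
have [e0 se e1] := e_pmf k.+1.
have [||_] := @tannery_dominated R
  (fun n v => e k.+1 v * binom_weight (t k n) v 0) (e k.+1) (e k.+1) se.
- move=> n v; rewrite normrM ler_piMr // ger0_norm ?binom_weight_ge0 //.
  exact: binom_weight_le1.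
- move=> v; rewrite -[X in _ --> X]mulr1; apply: cvgMr.
  have h : 1 - t k n @[n --> \oo] --> (1 : R).
    rewrite -[X in _ --> X]subr0; apply: cvgB; first exact: cvg_cst.
    exact: tail_prod_cvg0.
  have := @cvgn_exp _ _ _ v h; rewrite expr1n; apply: cvg_trans; apply: near_eq_cvg.
  by apply: nearW => n; rewrite /binom_weight bin0 expr0 !mul1r subn0.
- rewrite e1 => c; rewrite -(subrr 1).
  by apply: cvgB; [exact: cvg_cst|exact: c].
Qed.

Lemma moment_sum_lim i K : (0 < i)%N ->
  \sum_(K <= k < n) t k n ^+ i * moment (e k.+1) i @[n --> \oo] --> lam i.
Proof.
move=> i0.
have := weighted_sum_cvg rho01 rho_lim rho_sum (c := fun n => moment (e n) i)
  K i0 (lam_lim i0).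
apply: cvg_trans; apply: near_eq_cvg; apply: nearW => n.
by apply: eq_bigr => k _; rewrite mulrC.
Qed.

(** The first K cohorts are left out because the moments in use may be infinite for them. *)
Definition mass_from K n j := \sum_(K <= k < n) a k n j.

Lemma mass_from_ge0 K n j : 0 <= mass_from K n j.
Proof. exact: sumr_ge0. Qed.

Lemma initial_mass_lim K j : (0 < j)%N ->
  \sum_(0 <= k < K) a k n j @[n --> \oo] --> (0 : R).
Proof.
move=> j0; apply: (@cvgn_sum0 R (fun n k => a k n j) ) => k.
apply: squeeze_cvgr (cvg_cst 0) (survivors0_lim k).
by apply: nearW => n; rewrite a_ge0 survivors_le.
Qed.

Let inclusion_exclusion j I := (j`!%:R)^-1 * series (intensity_term lam j) I.

Lemma inclusion_exclusion_lim j : (0 < j)%N ->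
  inclusion_exclusion j I @[I --> \oo] --> intensity_mass lam j.
Proof. by move=> j0; apply: cvgMr; apply: lam_series. Qed.

(** [thin_bonferroni] summed over the cohorts from K on. [F n] is the truncated series with each
    lambda replaced by the corresponding weighted sum of factorial moments at time n. *)
Lemma truncated_inclusion_exclusion j I : (0 < j)%N -> exists K,
  exists F : nat -> R, F @ \oo --> inclusion_exclusion j I.+1 /\
    forall n, 0 <= (-1) ^+ I * (F n - mass_from K n j).
Proof.
move=> j0.
(* Each order has its own threshold; a truncated series involves finitely many orders, so a maximum
   exists. *)
have [K hK] : exists K, forall i n, (i <= I)%N -> (K <= n)%N ->
    abs_summable (fun v => e n v * (v ^_ (j + i))%:R).
  elim: I => [|I [K hK]].
    have [N hN] := e_moment (ltn_addr 0 j0); exists N => i n.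
    by rewrite leqn0 => /eqP ->; apply: hN.
  have [N hN] := e_moment (ltn_addr I.+1 j0); exists (maxn K N) => i n.
  rewrite geq_max leq_eqVlt => /orP[/eqP->|iI] /andP[Kn Nn]; first exact: hN.
  exact: hK.
exists K, (fun n => \sum_(0 <= i < I.+1) (-1) ^+ i / (j`!%:R * i`!%:R) *
  \sum_(K <= k < n) (t k n ^+ (j + i) * moment (e k.+1) (j + i))); split.
  have -> : inclusion_exclusion j I.+1 =
      \sum_(0 <= i < I.+1) (-1) ^+ i / (j`!%:R * i`!%:R) * lam (j + i)%N.
    rewrite /inclusion_exclusion /series /= mulr_sumr; apply: eq_bigr => i _.
    by rewrite /intensity_term invfM; ring.
  apply: (@cvgn_sum R (fun n i => _ * \sum_(K <= k < n)
    (t k n ^+ (j + i) * moment (e k.+1) (j + i)))) => i.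
  by apply: cvgMr; apply: moment_sum_lim; rewrite addn_gt0 j0.
move=> n.
have -> : \sum_(0 <= i < I.+1) (-1) ^+ i / (j`!%:R * i`!%:R) *
  \sum_(K <= k < n) (t k n ^+ (j + i) * moment (e k.+1) (j + i)) =
  \sum_(K <= k < n) \sum_(0 <= i < I.+1) (-1) ^+ i / (j`!%:R * i`!%:R) *
    (t k n ^+ (j + i) * moment (e k.+1) (j + i)).
  by rewrite exchange_big /=; apply: eq_bigr => i _; rewrite mulr_sumr.
rewrite -sumrB mulr_sumr big_nat; apply: sumr_ge0 => k /andP[Kk _].
have [e0 se _] := e_pmf k.+1; apply: thin_bonferroni => // i iI.
by apply: hK => //; apply: leqW.
Qed.

Lemma mass_lim0 j : (0 < j)%N ->
  mass_from 0 n j @[n --> \oo] --> intensity_mass lam j.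
Proof.
move=> j0; apply/cvgnP => d d0.
have d4 : 0 < d / 4 by rewrite divr_gt0.
move/cvgnP/(_ _ d4): (inclusion_exclusion_lim j0) => [N hN].
(* An upper bound for even I and a lower bound for odd I. Three errors of d/4 each: of [F], of the
   truncation, and of the first K cohorts. *)
have close I : (N <= I)%N -> exists n0, forall n, (n0 <= n)%N ->
    (-1) ^+ I * (mass_from 0 n j - intensity_mass lam j) <= d.
  move=> NI; have [K [F [hF FM]]] := truncated_inclusion_exclusion I j0.
  move/cvgnP/(_ _ d4): hF => [n1 h1].
  move/cvgnP/(_ _ d4): (@initial_mass_lim K j j0) => [n2 h2].
  exists (maxn K (maxn n1 n2)) => n; rewrite !geq_max => /and3P[Kn /h1 H1 /h2 H2].
  have H3 := hN I.+1 (leqW NI); have H4 := FM n.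
  have E : mass_from 0 n j = \sum_(0 <= k < K) a k n j + mass_from K n j.
    by rewrite /mass_from (big_cat_nat (leq0n _) Kn).
  rewrite E; move: H1 H2 H3 H4; rewrite subr0 !ler_norml.
  by rewrite -signr_odd; case: (odd I); rewrite ?expr0 ?expr1 ?mul1r ?mulN1r; lra.
(* One truncation of each parity beyond N. *)
have [n1 h1] := close N.*2 (leq_trans (leq_addr N N) (eq_leq (addnn N))).
have [n2 h2] := close N.*2.+1 (leqW (leq_trans (leq_addr N N) (eq_leq (addnn N)))).
exists (maxn n1 n2) => n; rewrite geq_max => /andP[/h1 H1 /h2 H2].
have sg : (-1) ^+ N.*2 = 1 :> R by rewrite -signr_odd odd_double.
by move: H1 H2; rewrite exprS sg mulr1 mul1r mulN1r ler_norml; lra.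
Qed.

Lemma mass_lim K j : (0 < j)%N ->
  mass_from K n j @[n --> \oo] --> intensity_mass lam j.
Proof.
move=> j0; have c := cvgn_sub (mass_lim0 j0) (initial_mass_lim K j0).
rewrite subr0 in c; apply: (eventually_eq_cvgn (N := K) c) => n Kn.
by rewrite /mass_from (big_cat_nat (leq0n _) Kn) /= addrAC subrr add0r.
Qed.

Definition intensity j := if j is 0%N then 0 else intensity_mass lam j.

(** The sign cannot be read off the alternating series; it is inherited from the nonnegative masses
    whose limit the series is. *)
Lemma intensity_ge0 j : 0 <= intensity j.
Proof.
case: j => [//|j] /=; rewrite -(cvg_lim _ (@mass_lim0 j.+1 _)) //.
apply: limr_ge; first by apply/cvg_ex; eexists; apply: mass_lim0.
by apply: nearW => n; apply: mass_from_ge0.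
Qed.

Let mass_pos K n j := if j is 0%N then 0 else mass_from K n j.

Lemma mass_pos_lim K j : mass_pos K n j @[n --> \oo] --> intensity j.
Proof. by case: j => [|j]; [exact: cvg_cst|exact: mass_lim]. Qed.

Let mass_pos_ge0 K n j : 0 <= mass_pos K n j.
Proof. by case: j => // j; apply: mass_from_ge0. Qed.

(** [B n] is the mean number of survivors from the cohorts K, K+1, ... . First moments serve twice:
    Markov's inequality bounds the probability that a cohort survives, and bounded means prevent
    mass from escaping to large j. *)
Lemma mean_bound : exists K, exists B : nat -> R, B @ \oo --> lam 1%N /\
  (forall n k, (K <= k < n)%N -> 1 - a k n 0%N <= t k n * moment (e k.+1) 1) /\
  (forall n J, \sum_(0 <= j < J) mass_pos K n j * j%:R <= B n).
Proof.
have [K hK] := e_moment (ltnSn 0).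
have sm k : (K <= k)%N -> abs_summable (fun v => e k.+1 v * v%:R).
  move=> Kk; have := hK k.+1 (leqW Kk).
  by under [X in abs_summable X]eq_fun do rewrite ffactn1.
exists K, (fun n => \sum_(K <= k < n) t k n ^+ 1 * moment (e k.+1) 1); split.
  exact: moment_sum_lim.
have mean k n J : (K <= k)%N ->
    \sum_(0 <= j < J) a k n j * j%:R <= t k n * moment (e k.+1) 1.
  by move=> Kk; have [e0 se _] := e_pmf k.+1; apply: thin_mean_le => //; apply: sm.
split=> [n k /andP[Kk kn]|n J].
  have [a0 sa a1] := survivors_pmf k n; rewrite lerBlDr -a1.
  apply: tsum_le_bound => // J; apply: le_trans (ler_sum_widen a0 (leqnSn J)) _.
  rewrite big_nat_recl // addrC lerD2r; apply: le_trans (mean k n J.+1 Kk).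
  rewrite [leRHS]big_nat_recl // mulr0 add0r; apply: ler_sum => j _.
  by rewrite ler_peMr // ler1n.
apply: (@le_trans _ _ (\sum_(K <= k < n) \sum_(0 <= j < J) a k n j * j%:R)).
  rewrite exchange_big /=; apply: ler_sum => -[|j] _.
    by rewrite mul0r sumr_ge0 // => k _; rewrite mulr0.
  by rewrite /= /mass_from mulr_suml.
by rewrite !big_nat; apply: ler_sum => k /andP[Kk _]; rewrite expr1 mean.
Qed.

Lemma intensity_mean_le J : \sum_(0 <= j < J) intensity j * j%:R <= lam 1%N.
Proof.
have [K [B [hB [_ hM]]]] := mean_bound.
have c : \sum_(0 <= j < J) mass_pos K n j * j%:R @[n --> \oo] -->
    \sum_(0 <= j < J) intensity j * j%:R.
  apply: (@cvgn_sum R (fun n j => mass_pos K n j * j%:R)) => j.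
  by apply: cvgMl; apply: mass_pos_lim.
rewrite -(cvg_lim _ c) // -(cvg_lim _ hB) //; apply: ler_lim.
- by apply/cvg_ex; eexists; exact: c.
- by apply/cvg_ex; eexists; exact: hB.
- by apply: nearW => n; apply: hM.
Qed.

Lemma lam1_ge0 : 0 <= lam 1%N.
Proof. by apply: le_trans (intensity_mean_le 0); rewrite big_geq. Qed.

(** To be used with the real and imaginary parts of z^j - 1. The condition at 0 removes the event
    that a cohort has died out, whose probabilities summed over the cohorts do not stay bounded. *)
Lemma intensity_lim (phi : nat -> R) C : (forall j, `|phi j| <= C) ->
  phi 0%N = 0 ->
  abs_summable intensity /\
  \sum_(0 <= k < n) tsum (fun j => a k n j * phi j) @[n --> \oo] -->
    tsum (fun j => intensity j * phi j).
Proof.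
move=> hC phi0; have [K [B [hB [_ hM]]]] := mean_bound.
have C0 : 0 <= C by apply: le_trans (hC 0%N).
have smass n : abs_summable (mass_pos K n).
  apply: (@abs_summable_le _ _ (mass_from K n) 1).
    by apply: abs_summable_sum => k _.
  by move=> [|j]; rewrite mul1r // normr0.
have tail : forall d, 0 < d -> exists N, exists n0, forall n M, (n0 <= n)%N ->
    \sum_(N <= j < M) `|mass_pos K n j| <= d.
  move=> d d0; move/cvgnP/(_ _ ltr01): hB => [n0 h0].
  (* Markov's inequality: the mass from N on is at most [B n] / N, and [B n] is eventually at most
     [lam 1] + 1. *)
  pose N := (Num.truncn ((lam 1%N + 1) / d)).+1.
  have hN : lam 1%N + 1 <= N%:R * d.
    by rewrite -ler_pdivrMr // ltW // truncnS_gt.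
  exists N, n0 => n M /h0 h; have N0 : 0 < N%:R :> R by rewrite ltr0n.
  rewrite -(ler_pM2l N0); apply: le_trans hN.
  apply: (@le_trans _ _ (B n)); last by move: h; rewrite ler_norml; lra.
  apply: le_trans (hM n M); rewrite mulr_sumr.
  have [NM|/ltnW MN] := leqP N M; last first.
    by rewrite big_geq // sumr_ge0 // => j _; rewrite mulr_ge0.
  rewrite [leRHS](big_cat_nat (leq0n _) NM) /=.
  apply: (@le_trans _ _ (\sum_(N <= j < M) mass_pos K n j * j%:R)).
    rewrite !big_nat; apply: ler_sum => j /andP[Nj _].
    by rewrite ger0_norm // mulrC ler_wpM2l // ler_nat.
  by rewrite lerDr sumr_ge0 // => j _; rewrite mulr_ge0.
have [si _] := tannery smass (mass_pos_lim K) tail; split=> //.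
have [] := @tannery R (fun n j => mass_pos K n j * phi j)
  (fun j => intensity j * phi j).
- by move=> n; apply: abs_summable_mulr hC.
- by move=> j; apply: cvgMl; apply: mass_pos_lim.
- move=> d d0; have C1 : 0 < C + 1 by rewrite ltr_wpDl.
  have [N [n0 h]] := tail (d / (C + 1)) (divr_gt0 d0 C1).
  exists N, n0 => n M /h H.
  apply: (@le_trans _ _ (\sum_(N <= j < M) `|mass_pos K n j| * C)).
    by apply: ler_sum => j _; rewrite normrM ler_wpM2l.
  rewrite -mulr_suml; apply: le_trans (ler_wpM2r C0 (H _)) _.
  by rewrite mulrAC ler_pdivrMr // ler_wpM2l ?lerDl // ltW.
move=> _ c.
(* The K cohorts left out contribute at most C times their probabilities of having a survivor. *)
have i0 : \sum_(0 <= k < K) tsum (fun j => a k n j * phi j) @[n --> \oo] --> (0 : R).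
  apply: (@cvgn_sum0 R (fun n k => tsum (fun j => a k n j * phi j)) ) => k.
  have bnd n : `|tsum (fun j => a k n j * phi j)| <= C * (1 - a k n 0%N).
    have [a0 sa a1] := survivors_pmf k n.
    have sp := abs_summable_mulr sa hC.
    rewrite (psum_tsum_tail 1 sp) big_nat1 phi0 mulr0 add0r.
    have -> : 1 - a k n 0%N = tsum (fun j => if (j < 1)%N then 0 else a k n j).
      by rewrite -a1 (psum_tsum_tail 1 sa) big_nat1 addrAC subrr add0r.
    have s1 : abs_summable (fun j => if (j < 1)%N then 0 else a k n j).
      by apply: (@abs_summable_le _ _ _ 1 sa) => j; case: ifP; rewrite ?normr0 mul1r.
    have s2 : abs_summable (fun j => if (j < 1)%N then 0 else a k n j * phi j).
      by apply: (@abs_summable_le _ _ _ 1 sp) => j; case: ifP; rewrite ?normr0 mul1r.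
    apply: (le_trans (tsum_norm_le s2)); rewrite -tsumZ //; apply: tsum_le => [||j].
    + exact: abs_summable_norm.
    + exact: abs_summableZ.
    + case: ifP => _; first by rewrite normr0 mulr0.
      by rewrite normrM ger0_norm // mulrC ler_wpM2r.
  have b0 : C * (1 - a k n 0%N) @[n --> \oo] --> (0 : R).
    by rewrite -[X in _ --> X](mulr0 C); apply: cvgMr; apply: survivors0_lim.
  apply/cvgnP => d d0; move/cvgnP/(_ _ d0): b0 => [N hN]; exists N => n /hN.
  rewrite !subr0; apply: le_trans; apply: le_trans (bnd n) _; exact: ler_norm.
have c' := cvgn_add i0 c; rewrite add0r in c'.
apply: (eventually_eq_cvgn (N := K) c') => n Kn.
rewrite [RHS](big_cat_nat (leq0n _) Kn) /=; congr (_ + _).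
rewrite -tsum_sum; last by move=> k _; apply: abs_summable_mulr hC.
congr tsum; apply/funext => -[|j].
  by rewrite mul0r big1 // => k _; rewrite phi0 mulr0.
by rewrite /= /mass_from mulr_suml.
Qed.

(** With m the mean immigration, the summand is at most (t m)^2. Since m/(1 - rho) converges and m
    tends to 0, m^2/(2 (1 - rho)) tends to 0, and Toeplitz summation of order 2 applies. *)
Lemma sum_sqr_lim : \sum_(0 <= k < n) (1 - a k n 0%N) ^+ 2 @[n --> \oo] --> (0 : R).
Proof.
have [K [B [_ [hK _]]]] := mean_bound.
have m0 : moment (e n.+1) 1 @[n --> \oo] --> (0 : R).
  have r1 : 1 - rho n.+1 @[n --> \oo] --> (0 : R).
    rewrite -(subrr 1); apply: cvgB; first exact: cvg_cst.
    by move: rho_lim; rewrite -(@cvg_shiftS R^o).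
  have c := cvgn_mul (lam_lim (ltnSn 0)) r1; rewrite mulr0 in c.
  apply: (eventually_eq_cvgn (N := 0%N) c) => n _; rewrite mul1r divfK //.
  by rewrite subr_eq0 eq_sym lt_eqF //; case/andP: (rho01 (ltn0Sn n)).
have c2 : moment (e n.+1) 1 ^+ 2 / (2%:R * (1 - rho n.+1)) @[n --> \oo] --> (0 : R).
  have h : (fun=> 2^-1 : R) @ \oo --> (2^-1 : R) by exact: cvg_cst.
  have c := cvgn_mul (cvgn_mul (lam_lim (ltnSn 0)) m0) h.
  rewrite mulr0 mul0r in c; apply: (eventually_eq_cvgn (N := 0%N) c) => n _.
  have d : 1 - rho n.+1 != 0.
    by rewrite subr_eq0 eq_sym lt_eqF //; case/andP: (rho01 (ltn0Sn n)).
  by field.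
have w := weighted_sum_cvg rho01 rho_lim rho_sum
  (c := fun n => moment (e n) 1 ^+ 2) K (ltn0Sn 1) c2.
have i0 : \sum_(0 <= k < K) (1 - a k n 0%N) ^+ 2 @[n --> \oo] --> (0 : R).
  apply: (@cvgn_sum0 R (fun n k => (1 - a k n 0%N) ^+ 2) ) => k.
  by have := @cvgn_exp _ _ _ 2 (survivors0_lim k); rewrite expr0n.
have := cvgn_add i0 w; rewrite addr0 => s.
apply: squeeze_cvgr (cvg_cst 0) s; exists K => // n /= Kn.
rewrite sumr_ge0 /=; last by move=> k _; apply: sqr_ge0.
rewrite (big_cat_nat (leq0n _) Kn) /= lerD2l !big_nat; apply: ler_sum => k Kk.
rewrite -exprMn mulrC; have [a0 _ _] := survivors_pmf k n.
have h0 : 0 <= 1 - a k n 0%N by rewrite subr_ge0 pmf_le1 //; apply: survivors_pmf.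
by rewrite ler_pXn2r ?nnegrE // ?(le_trans h0) //; apply: hK.
Qed.

Local Open Scope complex_scope.

Definition log_gf (z : R[i]) : R[i] :=
  tsum (fun j => intensity j * complex.Re (z ^+ j - 1)) +i*
  tsum (fun j => intensity j * complex.Im (z ^+ j - 1)).

Lemma norm_exp_sub1 (z : R[i]) j : `|z| <= 1 ->
  `|complex.Re (z ^+ j - 1)| <= 2 /\ `|complex.Im (z ^+ j - 1)| <= 2.
Proof.
move=> z1; rewrite ReB ImB /= subr0.
have := norm_Re_exp j z1; have := norm_Im_exp j z1.
by rewrite !ler_norml; lra.
Qed.

Lemma prod_gf_lim (z : R[i]) : `|z| <= 1 ->
  complex.Re (\prod_(0 <= k < n) gf (a k n) z) @[n --> \oo] -->
    complex.Re (cexp (log_gf z)) /\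
  complex.Im (\prod_(0 <= k < n) gf (a k n) z) @[n --> \oo] -->
    complex.Im (cexp (log_gf z)).
Proof.
move=> z1.
pose S n := \sum_(0 <= k < n) (gf (a k n) z - 1).
have SE k n : gf (a k n) z - 1 =
    tsum (fun j => a k n j * complex.Re (z ^+ j - 1)) +i*
    tsum (fun j => a k n j * complex.Im (z ^+ j - 1)).
  by have [a0 sa a1] := survivors_pmf k n; apply: gf_sub1E.
have SR : complex.Re (S n) @[n --> \oo] --> complex.Re (log_gf z).
  have := intensity_lim (fun j => (norm_exp_sub1 j z1).1).
  rewrite expr0 subrr => /(_ erefl)[_]; apply: cvg_trans; apply: near_eq_cvg.
  by apply: nearW => n; rewrite /= /S Re_sum; apply: eq_bigr => k _; rewrite SE.
have SI : complex.Im (S n) @[n --> \oo] --> complex.Im (log_gf z).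
  have := intensity_lim (fun j => (norm_exp_sub1 j z1).2).
  rewrite expr0 subrr => /(_ erefl)[_]; apply: cvg_trans; apply: near_eq_cvg.
  by apply: nearW => n; rewrite /= /S Im_sum; apply: eq_bigr => k _; rewrite SE.
have [cR cI] := cvg_cexp SR SI.
(* 24 = 3 (2^2 + 2^2), from [cexp_first_order] and the two bounds of [norm_gf_sub1_le]. *)
pose E n := \sum_(0 <= k < n) 24 * (1 - a k n 0%N) ^+ 2.
have hE : E n @[n --> \oo] --> (0 : R).
  rewrite -[X in _ --> X](mulr0 24).
  have -> : E = fun n => 24 * \sum_(0 <= k < n) (1 - a k n 0%N) ^+ 2.
    by apply/funext => n; rewrite /E mulr_sumr.
  by apply: cvgMr; apply: sum_sqr_lim.
have dist n : `|\prod_(0 <= k < n) gf (a k n) z - cexp (S n)| <= (E n)%:C.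
  rewrite cexp_sum; apply: (le_trans (dist_prod_le _ _ _ _)).
  - move=> k; have [a0 sa a1] := survivors_pmf k n.
    by apply: norm_gf_le1 => //; rewrite a1.
  - move=> k; have [a0 sa a1] := survivors_pmf k n.
    rewrite norm_cexp (_ : 1 = 1%:C) // lecR expR_le1.
    exact: Re_gf_sub1_le0.
  - rewrite /E rmorph_sum /=; apply: ler_sum => k _.
    have [a0 sa a1] := survivors_pmf k n.
    have := cexp_first_order (Re_gf_sub1_le0 a0 sa a1 z1).
    rewrite [1 + _]addrC subrK => /le_trans; apply; rewrite lecR.
    have [] := norm_gf_sub1_le a0 sa a1 z1.
    set x := complex.Re _; set y := complex.Im _; set d := 1 - _.
    rewrite -(real_normK (num_real x)) -(real_normK (num_real y)).
    by have := normr_ge0 x; have := normr_ge0 y; nra.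
have close (f : R[i] -> R) (l : R) :
    (forall u v w, `|u - v| <= w%:C -> `|f u - f v| <= w) ->
    f (cexp (S n)) @[n --> \oo] --> l ->
    f (\prod_(0 <= k < n) gf (a k n) z) @[n --> \oo] --> l.
  move=> hf c; apply/cvgnP => d d0; have d2 : 0 < d / 2 by rewrite divr_gt0.
  move/cvgnP/(_ _ d2): c => [N hN]; move/cvgnP/(_ _ d2): hE => [M hM].
  exists (maxn N M) => n; rewrite geq_max => /andP[/hN h1 /hM].
  rewrite subr0 => /(le_trans (ler_norm _)) h2; have h3 := hf _ _ _ (dist n).
  by move: h1 h3; rewrite !ler_norml; lra.
split; apply: close => // u v w h; rewrite -?ReB -?ImB.
- exact: norm_Re_le.
- exact: norm_Im_le.
Qed.

(** Combines exp s >= 1 + s, Bernoulli's inequality 1 - x^j <= j (1 - x) and the mean bound of the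
    intensity. As x tends to 1 it shows that no mass is lost in the limit. *)
Lemma log_gf_real (x : R) : 0 < x < 1 ->
  complex.Re (cexp (log_gf x%:C)) >= 1 - lam 1%N * (1 - x).
Proof.
move=> /andP[x0 x1].
have x01 : `|x%:C| <= 1.
  by rewrite ger0_norm ?ler0c ?(ltW x0) // (_ : 1 = 1%:C) // lecR ltW.
have x0E : complex.Re (x%:C ^+ 0 - 1) = 0 by rewrite expr0 subrr.
have [si _] := intensity_lim (fun j => (norm_exp_sub1 j x01).1) x0E.
have ReX j : complex.Re (x%:C ^+ j - 1) = x ^+ j - 1 by rewrite -rmorphXn ReB.
have ImX j : complex.Im (x%:C ^+ j - 1) = 0 by rewrite -rmorphXn ImB /= subrr.
have -> : log_gf x%:C = (tsum (fun j => intensity j * (x ^+ j - 1)))%:C.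
  rewrite /log_gf; congr (_ +i* _).
    by congr tsum; apply/funext => j; rewrite ReX.
  rewrite -[RHS](tsum0 R); congr tsum; apply/funext => j; rewrite ImX mulr0 //.
rewrite /cexp /= cos0 sin0 mulr1 mul0r subr0; apply: le_trans (expR_ge1Dx _).
rewrite lerD2l lerNl.
have s1 : abs_summable (fun j => intensity j * (x ^+ j - 1)).
  apply: (abs_summable_mulr si (C := 1)) => j.
  have := exprn_ile1 j (ltW x0) (ltW x1); have := exprn_ge0 j (ltW x0).
  by rewrite ler_norml; lra.
have -> : - tsum (fun j => intensity j * (x ^+ j - 1)) =
    tsum (fun j => (-1) * (intensity j * (x ^+ j - 1))).
  by rewrite tsumZ // mulN1r.
apply: tsum_le_bound; first exact: abs_summableZ.
move=> n; apply: le_trans (ler_wpM2r _ (intensity_mean_le n)); last first.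
  by rewrite subr_ge0 ltW.
rewrite mulr_suml; apply: ler_sum => j _.
have bern : 1 - x ^+ j <= j%:R * (1 - x).
  elim: j => [|j IH]; first by rewrite expr0 subrr mul0r.
  have h : 0 <= (1 - x ^+ j) * (1 - x).
    by rewrite mulr_ge0 // subr_ge0 ?exprn_ile1 // ltW.
  by rewrite exprS -natr1; lra.
by have := ler_wpM2l (intensity_ge0 j) bern; lra.
Qed.

Variable p : nat -> nat -> R.
Hypotheses (p0 : p 0%N = fun k => (k == 0%N)%:R)
  (pS : forall n, p n.+1 = conv (thin (rho n.+1) (p n)) (e n.+1)).

Let rho_le1 n : 0 <= rho n.+1 <= 1.
Proof. by have /andP[-> /ltW ->] := rho01 (ltn0Sn n). Qed.

Lemma chain_pmf n : pmf (p n).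
Proof.
elim: n => [|n IH]; last by rewrite pS; apply: pmf_conv => //; apply: pmf_thin.
have h k : (1 <= k)%N -> (k == 0%N)%:R = 0 :> R by case: k.
rewrite p0; split=> //; first exact: finite_abs_summable h.
by rewrite (tsum_finite h) big_nat1.
Qed.

Lemma gf_chain n z : `|z| <= 1 -> gf (p n) z = \prod_(0 <= k < n) gf (a k n) z.
Proof.
move=> z1; transitivity (\prod_(0 <= k < n)
    gf (e k.+1) ((1 - t k n)%:C + (t k n)%:C * z)); last first.
  by apply: eq_bigr => k _; have [e0 se _] := e_pmf k.+1; rewrite gf_thin.
(* The point must be generalized: the last step of the recursion evaluates the previous generating
   function at 1 - rho + rho z, and such substitutions compose by multiplying survival
   probabilities. *)
elim: n z z1 => [|n IH] z z1.
  rewrite big_geq // p0.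
  have h (f : nat -> R) k : (1 <= k)%N -> (k == 0%N)%:R * f k = 0.
    by case: k => // k; rewrite mul0r.
  by rewrite /gf !(tsum_finite (h _)) !big_nat1 expr0 mul1r mulr0.
have [q0 sq _] := chain_pmf n; have [e0 se _] := e_pmf n.+1.
have [_ st _] := pmf_thin (rho_le1 n) (chain_pmf n).
rewrite pS gf_conv // gf_thin // IH; last exact: norm_convex_comb.
rewrite [RHS](big_nat_recr _ _ _ (leq0n n)); apply: f_equal2; last first.
  by rewrite /t tail_prodnn subrr mul1r add0r.
rewrite [LHS]big_nat [RHS]big_nat; apply: eq_bigr => k /andP[_ kn].
congr (gf _ _).
by rewrite /t tail_prodS // !rmorphB !rmorphM /= rmorph1; ring.
Qed.

Lemma chain_cvg : exists q, [/\ pmf q, (forall k, p n k @[n --> \oo] --> q k) &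
  forall z : R[i], `|z| <= 1 -> gf q z = cexp (log_gf z)].
Proof.
have gf_lim z : `|z| <= 1 ->
    complex.Re (gf (p n) z) @[n --> \oo] --> complex.Re (cexp (log_gf z)) /\
    complex.Im (gf (p n) z) @[n --> \oo] --> complex.Im (cexp (log_gf z)).
  move=> z1; have [hR hI] := prod_gf_lim z1; split.
  - by apply: (eventually_eq_cvgn (N := 0%N) hR) => n _; rewrite gf_chain.
  - by apply: (eventually_eq_cvgn (N := 0%N) hI) => n _; rewrite gf_chain.
have x_norm (x : R) : 0 < x < 1 -> `|x%:C| <= 1.
  move=> /andP[x0 x1].
  by rewrite ger0_norm ?ler0c ?(ltW x0) // (_ : 1 = 1%:C) // lecR ltW.
have Re_real (b : nat -> R) (x : R) :
    complex.Re (gf b x%:C) = tsum (fun i => b i * x ^+ i).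
  by rewrite /gf /=; congr tsum; apply/funext => i; rewrite -rmorphXn.
have G_lim (x : R) : 0 < x < 1 -> tsum (fun i => p n i * x ^+ i) @[n --> \oo] -->
    complex.Re (cexp (log_gf x%:C)).
  move=> x01; have [h _] := gf_lim _ (x_norm x x01).
  by apply: (eventually_eq_cvgn (N := 0%N) h) => n _; rewrite Re_real.
have pq k : p n k @[n --> \oo] --> limn (fun n => p n k).
  exact: (@cvg_coefficients R p (fun x => complex.Re (cexp (log_gf x%:C))) chain_pmf
    G_lim k).
pose q k := limn (fun n => p n k).
have q0 k : 0 <= q k.
  apply: limr_ge; first by apply/cvg_ex; eexists; exact: pq.
  by apply: nearW => n; have [] := chain_pmf n.
have q_le n : \sum_(0 <= k < n) q k <= 1.
  have c := @cvgn_sum R p q 0 n pq; rewrite -(cvg_lim _ c) //; apply: limr_le.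
    by apply/cvg_ex; eexists; exact: c.
  apply: nearW => m; have [pm0 sp <-] := chain_pmf m.
  exact: psum_le_tsum.
have sq : abs_summable q by apply: bounded_abs_summable q_le.
have qG x : 0 < x < 1 -> 1 - lam 1%N * (1 - x) <= tsum q.
  move=> x01; apply: (le_trans (log_gf_real x01)).
  have /andP[x0 x1] := x01.
  have xk k : 0 <= x ^+ k <= 1 by rewrite exprn_ge0 ?exprn_ile1 // ltW.
  have sx : abs_summable (fun k => x ^+ k).
    apply: ge0_abs_summable => [k|]; first by case/andP: (xk k).
    have -> : (fun k => x ^+ k) = geometric 1 x.
      by apply/funext => k; rewrite /geometric /= mul1r.
    by apply: is_cvg_geometric_series; rewrite ger0_norm // ltW.
  (* Tightness of [p n] is not known yet; for x < 1 the geometric series is a majorant, since each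
     [p n k] is at most 1. *)
  have [] := @tannery_dominated R (fun n k => p n k * x ^+ k)
    (fun k => q k * x ^+ k) (fun k => x ^+ k) sx.
  - move=> n k; rewrite normrM ler_piMl //; have [pn0 _ _] := chain_pmf n.
    by rewrite ger0_norm // pmf_le1 //; apply: chain_pmf.
  - by move=> k; apply: cvgMl; apply: pq.
  move=> sqx c; rewrite (cvg_unique _ (G_lim x x01) c) //.
  apply: tsum_le => // k; have /andP[h0 h1] := xk k.
  by rewrite ler_piMr.
have q_pmf : pmf q.
  split=> //; apply/eqP; rewrite eq_le tsum_le_bound //= leNgt; apply/negP => q1.
  have l0 := lam1_ge0.
  (* At x = 1 - s the bound [qG] says that the missing mass is at most [lam 1] times s, whereas s is
     chosen to make this at most half of the missing mass; the 1 added to [lam 1] covers [lam 1] =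
     0. *)
  pose s := Num.min 2^-1 ((1 - tsum q) / (2 * (lam 1%N + 1))).
  have d0 : 0 < 2 * (lam 1%N + 1) by lra.
  have s0 : 0 < s by rewrite lt_min invr_gt0 ltr0n /= divr_gt0 // subr_gt0.
  have s1 : s < 1 by rewrite gt_min invf_lt1 ?ltr0n // ltr1n.
  have s2 : s * (2 * (lam 1%N + 1)) <= 1 - tsum q.
    by rewrite -ler_pdivlMr // ge_min lexx orbT.
  have x01 : 0 < 1 - s < 1 by lra.
  by have := qG _ x01; have := mulr_ge0 l0 (ltW s0); nra.
(* With [q] a probability distribution, [scheffe] carries the convergence to the whole closed disc,
   and uniqueness of limits identifies [gf q z]. *)
exists q; split=> // z z1; have [hR hI] := gf_lim z z1.
apply: complex_eqP.
- apply: (cvg_unique _ _ hR) => //.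
  exact: (scheffe chain_pmf q_pmf pq (fun k => norm_Re_exp k z1)).
- apply: (cvg_unique _ _ hI) => //.
  exact: (scheffe chain_pmf q_pmf pq (fun k => norm_Im_exp k z1)).
Qed.

End ThinnedArray.

(** * Discrete laws *)

Section DiscreteMeasures.
Context (R : realType).

Lemma nneseries_tsum (u : nat -> R) : (forall k, 0 <= u k) -> abs_summable u ->
  (\sum_(0 <= k <oo) (u k)%:E = (tsum u)%:E)%E.
Proof.
move=> u0 su; rewrite /tsum -EFin_lim; last exact: abs_summable_cvg.
congr (limn _); apply/funext => n /=; exact: sumEFin.
Qed.

Lemma nneseries_abs_summable (u : nat -> R) : (forall k, 0 <= u k) ->
  (\sum_(0 <= k <oo) (u k)%:E < +oo)%E -> abs_summable u.
Proof. by move=> u0 h; apply: ge0_abs_summable => //; apply: nnseries_is_cvg. Qed.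

Lemma bigcup_preimage_set1 (S : Type) (W : S -> nat) (B : set S) :
  B = \bigcup_n (B `&` W @^-1` [set n]).
Proof.
apply/seteqP; split=> [w Bw|w [n _ []] //].
by exists (W w).
Qed.

Lemma trivIset_preimage_set1 (S : Type) (W : S -> nat) (B : set S) :
  trivIset setT (fun n => B `&` W @^-1` [set n]).
Proof. by move=> i j _ _ [w [[_ /= <-] [_ /= <-]]]. Qed.

(** The measure with mass [q k] at k, as a sum of scaled Dirac measures so that it inherits a
    measure structure. *)
Definition weights (q : nat -> R) (q0 : forall k, 0 <= q k) : set nat -> \bar R :=
  mseries (fun k => mscale (NngNum (q0 k)) (@dirac _ nat k R)) 0.

HB.instance Definition _ q (q0 : forall k, 0 <= q k) :=
  Measure.copy (weights q0)
    (mseries (fun k => mscale (NngNum (q0 k)) (@dirac _ nat k R)) 0).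

Lemma weights_set1 q (q0 : forall k, 0 <= q k) k : weights q0 [set k] = (q k)%:E.
Proof.
have h i : (k.+1 <= i)%N -> (i == k)%:R * q i = 0.
  by move=> ki; rewrite gtn_eqF // mul0r.
have u0 i : 0 <= (i == k)%:R * q i by rewrite mulr_ge0.
transitivity ((tsum (fun i => (i == k)%:R * q i))%:E).
  rewrite -nneseries_tsum //; last exact: finite_abs_summable h.
  apply: eq_eseriesr => i _; transitivity ((q i)%:E * \d_i [set k] : \bar R)%E => //.
  have -> : (i == k) = (i \in [set k]) by apply/eqP/idP; rewrite inE.
  by rewrite diracE muleC -EFinM.
rewrite (tsum_finite h) big_nat_recr //= eqxx mul1r big_nat big1 ?add0r // => i.
by move=> /andP[_ ik]; rewrite ltn_eqF // mul0r.
Qed.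

Lemma weights_setT q (q0 : forall k, 0 <= q k) : abs_summable q ->
  weights q0 setT = (tsum q)%:E.
Proof.
move=> sq; rewrite -nneseries_tsum //; apply: eq_eseriesr => i _.
transitivity ((q i)%:E * \d_i [set: nat] : \bar R)%E => //.
by rewrite diracT mule1.
Qed.

Lemma probability_of_pmf q : pmf q -> exists Q : probability nat R,
  forall k, Q [set k] = (q k)%:E.
Proof.
move=> [q0 sq q1].
have w1 : weights q0 setT = 1%E by rewrite weights_setT // q1.
pose H := Measure_isProbability.Build _ _ _ (weights q0) w1.
pose Q : probability nat R := HB.pack (weights q0) H.
by exists Q => k; apply: weights_set1.
Qed.

Lemma finite_measure_of_weights q : (forall k, 0 <= q k) -> abs_summable q ->
  exists m : {finite_measure set nat -> \bar R}, forall k, m [set k] = (q k)%:E.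
Proof.
move=> q0 sq.
have wf : fin_num_fun (weights q0).
  have wT : (weights q0 setT < +oo)%E by rewrite weights_setT // ltry.
  exact: lty_fin_num_fun.
pose H := Measure_isFinite.Build _ _ _ (weights q0) wf.
pose m : {finite_measure set nat -> \bar R} := HB.pack (weights q0) H.
by exists m => k; apply: weights_set1.
Qed.

Lemma probability_pmf (Q : probability nat R) : pmf (fun k => fine (Q [set k])).
Proof.
have E k : Q [set k] = (fine (Q [set k]))%:E by rewrite fineK // fin_num_measure.
have u0 k : 0 <= fine (Q [set k]) by apply: fine_ge0.
have S : (\sum_(0 <= k <oo) (fine (Q [set k]))%:E = 1)%E.
  rewrite -(probability_setT Q) (bigcup_preimage_set1 (@id nat) setT).
  rewrite measure_bigcup //; last exact: trivIset_preimage_set1.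
  rewrite [RHS]eseries_mkcond; apply: eq_eseriesr => k _.
  by rewrite in_setT setTI -E; congr (Q _).
have su : abs_summable (fun k => fine (Q [set k])).
  by apply: nneseries_abs_summable => //; rewrite S ltry.
by split=> //; apply: EFin_inj; rewrite -nneseries_tsum.
Qed.

Lemma integral_probability_nat (Q : probability nat R) (f : nat -> R) M :
  (forall k, `|f k| <= M) ->
  (\int[Q]_k (f k)%:E = (tsum (fun k => fine (Q [set k]) * f k))%:E)%E.
Proof.
move=> hM; have [u0 su _] := probability_pmf Q.
have If : Q.-integrable setT (EFin \o (f : nat -> measurableTypeR R)).
  apply: measurable_bounded_integrable => //.
    exact: le_lt_trans (@probability_le1 _ _ _ Q setT measurableT) (ltry 1).
  exists M; split; first exact: num_real.
  by move=> x Mx k _ /=; apply: le_trans (hM k) (ltW Mx).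
have cover : [set: nat] = \bigcup_k [set k].
  by apply/seteqP; split=> // k _; exists k.
rewrite [X in integral _ X]cover integral_bigcup //; last by rewrite -cover.
  transitivity (limn (EFin \o series (fun k => fine (Q [set k]) * f k))).
    congr (limn _); apply/funext => n /=; rewrite -sumEFin; apply: eq_bigr => k _.
    rewrite (eq_integral (cst (f k)%:E)); last by move=> i; rewrite inE => ->.
    by rewrite integral_cst // EFinM muleC fineK // fin_num_measure.
  by rewrite EFin_lim //; apply/abs_summable_cvg/abs_summable_mulr/hM.
by move=> i j _ _ [k [/= -> ->]].
Qed.

End DiscreteMeasures.

Section RandomVariables.
Context d (T : measurableType d) (R : realType) (P : probability T R).

Definition pr (A : set T) : R := fine (P A).

Lemma prE A : measurable A -> P A = (pr A)%:E.
Proof. by move=> mA; rewrite fineK // fin_num_measure. Qed.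

Lemma pr_ge0 A : 0 <= pr A.
Proof. exact: fine_ge0. Qed.

Lemma pr_bigcup (F : nat -> set T) : (forall n, measurable (F n)) ->
  trivIset setT F ->
  abs_summable (fun n => pr (F n)) /\ pr (\bigcup_n F n) = tsum (fun n => pr (F n)).
Proof.
move=> mF tF; have mU := bigcup_measurable (fun n (_ : setT n) => mF n).
have E : P (\bigcup_n F n) = (\sum_(0 <= n <oo) (pr (F n))%:E)%E.
  rewrite measure_bigcup // [LHS]eseries_mkcond; apply: eq_eseriesr => k _.
  by rewrite in_setT; apply: prE.
have su : abs_summable (fun n => pr (F n)).
  apply: nneseries_abs_summable => [k|]; first exact: pr_ge0.
  by rewrite -E prE // ltry.
split=> //; apply: EFin_inj; rewrite -prE // E nneseries_tsum // => k.
exact: pr_ge0.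
Qed.

Lemma rv_preimage_measurable (Y : {RV P >-> nat}) A : measurable (Y @^-1` A).
Proof. exact: measurable_funPTI. Qed.

Lemma rv_pmf (Y : {RV P >-> nat}) : pmf (fun k => pr (Y @^-1` [set k])).
Proof. exact: (probability_pmf (distribution P Y)). Qed.

Lemma expectation_nat (Y : {RV P >-> nat}) (g : nat -> R) :
  (forall k, 0 <= g k) ->
  ('E_P[fun w => g (Y w)] =
    \sum_(0 <= k <oo) (pr (Y @^-1` [set k]) * g k)%:E)%E.
Proof.
move=> g0; rewrite unlock (bigcup_preimage_set1 Y setT).
have mY k : measurable (setT `&` Y @^-1` [set k]).
  by rewrite setTI; apply: rv_preimage_measurable.
rewrite ge0_integral_bigcup //.
- apply: eq_eseriesr => k _.
  rewrite (eq_integral (cst (g k)%:E)); last by move=> w; rewrite inE => -[_ /= ->].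
  rewrite integral_cst // setTI EFinM muleC; congr (_ * _)%E.
  by apply: prE; apply: rv_preimage_measurable.
- rewrite -bigcup_preimage_set1 => _ B _; rewrite setTI.
  exact: (@rv_preimage_measurable Y ((fun k => (g k)%:E) @^-1` B)).
- by move=> w _; rewrite lee_fin.
- exact: trivIset_preimage_set1.
Qed.

End RandomVariables.

(** * The INAR(1) recursion *)

Section Independence.
Context d (T : measurableType d) (R : realType) (P : probability T R).
Context (I : choiceType) (Y : I -> {RV P >-> nat}).
Local Notation pr := (pr P).

(** Independence of one event from a subfamily, in place of a sigma-algebra of the past: the
    induction on time only ever conditions on {X n = y} and on values of partial sums. *)
Definition independent_event (B : set T) (S : set I) : Prop :=
  measurable B /\
  forall (J : {fset I}) (A : I -> set nat), (forall i, i \in J -> S i) ->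
    pr (B `&` \bigcap_(i in [set` J]) Y i @^-1` A i) =
    pr B * \prod_(i <- J) pr (Y i @^-1` A i).

Lemma independent_event_setT S : mutually_independent S Y ->
  independent_event setT S.
Proof.
move=> ind; split=> // J A JS; rewrite setTI.
have -> : pr setT = 1 by rewrite /pr probability_setT.
rewrite mul1r {1}/pr ind //.
rewrite (eq_bigr (fun i => (pr (Y i @^-1` A i))%:E)); last first.
  by move=> i _; apply: prE; apply: rv_preimage_measurable.
by rewrite prodEFin.
Qed.

Lemma independent_event_sub B S S' : S' `<=` S ->
  independent_event B S -> independent_event B S'.
Proof. by move=> sub [mB h]; split=> // J A JS; apply: h => i /JS /sub. Qed.

Lemma independent_event0 S : independent_event set0 S.
Proof.
split=> // J A _; rewrite set0I (_ : pr set0 = 0) ?mul0r //.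
by rewrite /pr measure0.
Qed.

Lemma independent_eventI B S i A : independent_event B S -> S i ->
  pr (B `&` Y i @^-1` A) = pr B * pr (Y i @^-1` A) /\
  independent_event (B `&` Y i @^-1` A) (S `\ i).
Proof.
move=> [mB ind] Si.
have E : pr (B `&` Y i @^-1` A) = pr B * pr (Y i @^-1` A).
  have := ind [fset i]%fset (fun=> A).
  rewrite bigcap_fset !big_seq_fset1; apply=> j.
  by rewrite inE => /eqP ->.
split=> //; split; first by apply: measurableI => //; apply: rv_preimage_measurable.
move=> J A' JS.
have iJ : i \notin J by apply/negP => /JS [_ /(_ erefl)].
(* The product rule is applied to J enlarged by i, with [A] prescribed at i and [A'] elsewhere. *)
pose A'' j := if j == i then A else A' j.
have A''J j : j \in J -> A'' j = A' j.
  by move=> jJ; rewrite /A''; case: eqP => // ji; move: iJ; rewrite -ji jJ.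
have := ind (i |` J)%fset A''.
rewrite !bigcap_fset !big_fsetU1 //= /A'' eqxx -/A''.
have -> : \big[setI/[set: T]]_(j <- J) (Y j @^-1` A'' j) =
    \big[setI/[set: T]]_(j <- J) (Y j @^-1` A' j).
  by rewrite big_seq [RHS]big_seq; apply: eq_bigr => j /A''J ->.
have -> : \prod_(j <- J) pr (Y j @^-1` A'' j) = \prod_(j <- J) pr (Y j @^-1` A' j).
  by rewrite big_seq [RHS]big_seq; apply: eq_bigr => j /A''J ->.
rewrite setIA mulrA E; apply=> j.
by rewrite !inE => /orP[/eqP ->|/JS []].
Qed.

(** Disjointness turns both sides into sums over n, to which the product rule applies term by term;
    general unions would not preserve independence. *)
Lemma independent_event_bigcup (F : nat -> set T) S : trivIset setT F ->
  (forall n, independent_event (F n) S) -> independent_event (\bigcup_n F n) S.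
Proof.
move=> tF ind; have mF n : measurable (F n) by have [] := ind n.
split; first exact: bigcup_measurable.
move=> J A JS; set E := \bigcap_(i in _) _; set c := \prod_(i <- J) _.
have mE : measurable E.
  rewrite /E bigcap_fset; apply: (big_ind measurable) => //.
    by move=> *; apply: measurableI.
  by move=> i _; apply: rv_preimage_measurable.
have tFE : trivIset setT (fun n => F n `&` E).
  by move=> i j _ _ [w [[Fi _] [Fj _]]]; apply: (tF i j) => //; exists w.
have [sF ->] := pr_bigcup P mF tF.
have [_] := pr_bigcup P (fun n => measurableI _ _ (mF n) mE) tFE.
rewrite -setI_bigcupl => ->; rewrite mulrC -tsumZ //; congr tsum.
by apply/funext => n; have [_ ->] := ind n; rewrite // mulrC.
Qed.

(** [W] is a bare function; measurability is asked only of its level sets inside [B]. *)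
Definition independent_on (B : set T) (W : T -> nat) S : Prop :=
  forall c, independent_event (B `&` W @^-1` [set c]) S.

Lemma independent_on_add B W S i : independent_on B W S -> S i ->
  independent_on B (fun w => W w + Y i w)%N (S `\ i) /\
  forall x, pr (B `&` (fun w => W w + Y i w)%N @^-1` [set x]) =
    conv (fun c => pr (B `&` W @^-1` [set c]))
         (fun v => pr (Y i @^-1` [set v])) x.
Proof.
move=> ind Si.
(* The guard excludes c > x, where the truncated difference x - c would be 0. *)
pose F x c := if (c < x.+1)%N then B `&` W @^-1` [set c] `&` Y i @^-1` [set (x - c)%N]
              else set0.
have FE x : B `&` (fun w => W w + Y i w)%N @^-1` [set x] = \bigcup_c F x c.
  apply/seteqP; split=> [w [Bw /= Wx]|w [c _]].
    exists (W w) => //; rewrite /F -Wx ltnS leq_addr; split=> //=.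
    by rewrite addKn.
  rewrite /F; case: ifP => // cx [[Bw /= Wc] /= ->]; split=> //=.
  by rewrite Wc subnKC.
have iF x c : independent_event (F x c) (S `\ i).
  rewrite /F; case: ifP => _; last exact: independent_event0.
  by have [] := independent_eventI [set (x - c)%N] (ind c) Si.
have tF x : trivIset setT (F x).
  move=> c c' _ _ [w []]; rewrite /F; case: ifP => // _ [[_ /= <-] _].
  by case: ifP => // _ [[_ /= <-] _].
split=> x; rewrite FE; first exact: independent_event_bigcup.
have [_ ->] := pr_bigcup P (fun c => (iF x c).1) (tF x).
rewrite (@tsum_finite _ _ x.+1); last first.
  by move=> c xc; rewrite /F ltnNge xc /= /pr measure0.
rewrite /conv !big_nat; apply: eq_bigr => c /andP[_ cx]; rewrite /F cx.
by have [] := independent_eventI [set (x - c)%N] (ind c) Si.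
Qed.

End Independence.

Section Recursion.
Context d (T : measurableType d) (R : realType) (P : probability T R).
Variables (xi : nat -> nat -> {RV P >-> nat}) (eps X : nat -> {RV P >-> nat}).
Hypothesis hX : inhomogeneous_INAR1 xi eps X.
Local Notation pr := (pr P).
Local Notation Y := (inar_input xi eps).
Local Notation rho := (offspring_mean xi).

Definition law (V : {RV P >-> nat}) k : R := pr (V @^-1` [set k]).

(** A 0-1 valued variable has its mean as success probability; it is written as a one-trial binomial
    law so that offspring sums build up binomial weights. *)
Lemma law_offspring n j : (0 < n)%N -> (0 < j)%N ->
  law (xi n j) = fun k => binom_weight (rho n) 1 k.
Proof.
move=> n0 j0.
have -> : law (xi n j) = law (xi n 1).
  apply/funext => k; rewrite /law /pr.
  by congr fine; exact: (inar_ident hX n0 j0 [set k]).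
have [l0 sl l1] : pmf (law (xi n 1)) := rv_pmf (xi n 1).
have l01 : law (xi n 1) 0 + law (xi n 1) 1 = 1.
  have : pr [set w | xi n 1 w \in [:: 0%N; 1%N]] = 1.
    by rewrite /pr (inar_bernoulli hX).
  move=> <-.
  have -> : [set w | xi n 1 w \in [:: 0%N; 1%N]] =
      xi n 1 @^-1` [set 0%N] `|` xi n 1 @^-1` [set 1%N].
    apply/seteqP; split=> w /=; rewrite !inE.
      by move=> /orP[/eqP|/eqP]; [left|right].
    by move=> [->|->].
  rewrite /pr measureU.
  - by rewrite fineD // fin_num_measure //; apply: rv_preimage_measurable.
  - exact: rv_preimage_measurable.
  - exact: rv_preimage_measurable.
  - by apply/seteqP; split=> w //= [->].
have l2 k : law (xi n 1) k.+2 = 0.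
  apply/eqP; rewrite eq_le l0 andbT.
  have := psum_le_tsum k.+3 l0 sl; rewrite l1 big_nat_recr //=.
  rewrite big_nat_recl // big_nat_recl // addrA l01 => h.
  have : 0 <= \sum_(0 <= i < k) law (xi n 1) i.+2 by apply: sumr_ge0.
  by move: h; lra.
have rhoE : rho n = law (xi n 1) 1.
  rewrite /offspring_mean (expectation_nat (xi n 1) (g := fun k => k%:R)) //.
  have h k : (2 <= k)%N -> pr (xi n 1 @^-1` [set k]) * k%:R = 0.
    by case: k => [|[|k]] // _; rewrite -/(law _ _) l2 mul0r.
  rewrite nneseries_tsum.
  - rewrite (tsum_finite h) big_nat_recr //= big_nat1.
    by rewrite mulr0 add0r mulr1.
  - by move=> k; rewrite mulr_ge0 // l0.
  - exact: finite_abs_summable h.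
apply/funext => -[|[|k]]; rewrite /binom_weight rhoE.
- by rewrite bin0 expr0 expr1 !mul1r; lra.
- by rewrite expr1 expr0 mulr1 mul1r.
- by rewrite bin_small // !mul0r l2.
Qed.

Lemma offspring_mean01 n : (0 < n)%N -> 0 <= rho n <= 1.
Proof.
move=> n0; have h : pmf (law (xi n 1)) := rv_pmf (xi n 1).
have -> : rho n = law (xi n 1) 1.
  by rewrite law_offspring // /binom_weight binn expr1 subnn expr0 mulr1 mul1r.
by rewrite pmf_le1 // andbT; case: h.
Qed.

Definition input_time (i : nat * nat + nat) : nat :=
  match i with inl nj => nj.1 | inr n => n end.

Definition future n : set (nat * nat + nat) :=
  [set i | inar_index i /\ (n < input_time i)%N].

Definition future_minus n m : set (nat * nat + nat) :=
  [set i | future n i /\ forall j, (j <= m)%N -> i <> inl (n.+1, j)].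

(** Pascal's rule: one more Bernoulli trial. The factor [p] will be the probability of {X n = y}. *)
Lemma conv_binom_weight (r : R) m c p :
  conv (fun c => p * binom_weight r m c) (fun k => binom_weight r 1 k) c =
  p * binom_weight r m.+1 c.
Proof.
have h k : (2 <= k)%N -> binom_weight r 1 k = 0 by move=> ?; rewrite binom_weight_small.
have b0 : binom_weight r 1 0 = 1 - r.
  by rewrite /binom_weight bin0 expr0 expr1 !mul1r.
have b1 : binom_weight r 1 1 = r.
  by rewrite /binom_weight binn expr1 expr0 mul1r mulr1.
rewrite /conv; case: c => [|c].
  rewrite big_nat1 b0 /binom_weight !bin0 !subn0 !expr0 exprS; ring.
rewrite big_nat_recr //= big_nat_recr //= subnn subSnn b0 b1.
rewrite big_nat big1 ?add0r; last first.
  by move=> i /andP[_ ic]; rewrite (h (c.+1 - i)%N) ?mulr0 //; lia.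
rewrite -mulrA -mulrA -mulrDr; congr (_ * _); rewrite /binom_weight binS natrD subSS.
have [mc|cm] := leqP m c.
  rewrite (bin_small (_ : (m < c.+1)%N)) // !exprS; ring.
have -> : (m - c = (m - c.+1).+1)%N by lia.
by rewrite !exprS; ring.
Qed.

(* On {X n = y} the random sum involves only finitely many inputs, so product
   rules over finite index sets suffice. *)
Lemma inar_step_law n : (forall y, independent_event Y (X n @^-1` [set y]) (future n)) ->
  forall y m, independent_on Y (X n @^-1` [set y])
      (fun w => \sum_(1 <= j < m.+1) xi n.+1 j w)%N (future_minus n m) /\
    forall c, pr (X n @^-1` [set y] `&`
      (fun w => \sum_(1 <= j < m.+1) xi n.+1 j w)%N @^-1` [set c]) =
      law (X n) y * binom_weight (rho n.+1) m c.
Proof.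
move=> ind y; elim=> [|m [IH1 IH2]].
  have E c : X n @^-1` [set y] `&`
      (fun w => \sum_(1 <= j < 1) xi n.+1 j w)%N @^-1` [set c] =
      if c == 0%N then X n @^-1` [set y] else set0.
    apply/seteqP; split=> w /=; rewrite big_geq //.
      by move=> [Xw <-].
    by case: eqP => [->|//].
  split=> c; rewrite E.
    case: eqP => _; last exact: independent_event0.
    by apply: independent_event_sub (ind y) => i [].
  case: eqP => [->|/eqP c0].
    by rewrite /binom_weight bin0 !expr0 !mulr1.
  by rewrite binom_weight_small ?lt0n // mulr0 /pr measure0.
have i0 : future_minus n m (inl (n.+1, m.+1)).
  by split=> [|j jm]; [split=> //=|move=> [E]; move: jm; rewrite -E ltnn].
have [H1 H2] := independent_on_add IH1 i0.
have S : (fun w => \sum_(1 <= j < m.+2) xi n.+1 j w)%N =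
    (fun w => \sum_(1 <= j < m.+1) xi n.+1 j w + Y (inl (n.+1, m.+1)) w)%N.
  by apply/funext => w; rewrite big_nat_recr.
rewrite S; split=> [c|c].
  apply: independent_event_sub (H1 c) => i [fi hi]; split; last exact: hi.
  by split=> // j jm; apply: hi; apply: leqW.
rewrite H2 -conv_binom_weight -(@law_offspring n.+1 m.+1) //.
by congr (conv _ _ c); apply/funext => k.
Qed.

Lemma inar_next n x : X n.+1 @^-1` [set x] =
  \bigcup_y (X n @^-1` [set y] `&`
    (fun w => \sum_(1 <= j < y.+1) xi n.+1 j w + Y (inr n.+1) w)%N @^-1` [set x]).
Proof.
apply/seteqP; split=> w /=.
  by rewrite (inar_step hX) //= => Xx; exists (X n w).
by move=> [y _ [/= Xy Wx]]; rewrite (inar_step hX) //= Xy.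
Qed.

Lemma inar_law n :
  (forall x, independent_event Y (X n @^-1` [set x]) (future n)) /\
  law (X n.+1) = conv (thin (rho n.+1) (law (X n))) (law (eps n.+1)).
Proof.
(* Independence from later inputs and the law of the next state come from the same decomposition
   along {X k = y}; the former drives the induction below. *)
have step k : (forall x, independent_event Y (X k @^-1` [set x]) (future k)) ->
  (forall x, independent_event Y (X k.+1 @^-1` [set x]) (future k.+1)) /\
  law (X k.+1) = conv (thin (rho k.+1) (law (X k))) (law (eps k.+1)).
  move=> ind.
  have H y : independent_on Y (X k @^-1` [set y])
      (fun w => \sum_(1 <= j < y.+1) xi k.+1 j w + Y (inr k.+1) w)%N (future k.+1) /\
    forall x, pr (X k @^-1` [set y] `&`
      (fun w => \sum_(1 <= j < y.+1) xi k.+1 j w + Y (inr k.+1) w)%N @^-1` [set x]) =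
      conv (fun c => law (X k) y * binom_weight (rho k.+1) y c) (law (eps k.+1)) x.
    have [H1 H2] := inar_step_law ind y y.
    have e0 : future_minus k y (inr k.+1) by [].
    have [G1 G2] := independent_on_add H1 e0; split=> x.
      apply: independent_event_sub (G1 x) => i [ix ti]; split.
        split=> [|j _ E]; first by split=> //; apply: ltnW.
        by move: ti; rewrite E /= ltnn.
      by move=> E; move: ti; rewrite E /= ltnn.
    by rewrite G2; congr (conv _ _ x); apply/funext => c; apply: H2.
  have tF x : trivIset setT (fun y => X k @^-1` [set y] `&`
    (fun w => \sum_(1 <= j < y.+1) xi k.+1 j w + Y (inr k.+1) w)%N @^-1` [set x]).
    by move=> y y' _ _ [w [[/= <- _] [/= <- _]]].
  split=> [x|].
    rewrite inar_next; apply: independent_event_bigcup => // y.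
    by have [G1 _] := H y; apply: G1.
  apply/funext => x; rewrite /law inar_next.
  have [_ ->] := pr_bigcup P (fun y => ((H y).1 x).1) (tF x).
  have [l0 sl _] : pmf (law (X k)) := rv_pmf (X k).
  have sb c : abs_summable (fun y => law (X k) y * binom_weight (rho k.+1) y c).
    exact: (abs_summable_thin_term (offspring_mean01 (ltn0Sn k)) sl).
  rewrite /conv; transitivity (tsum (fun y => \sum_(0 <= c < x.+1)
      law (eps k.+1) (x - c)%N * (law (X k) y * binom_weight (rho k.+1) y c))).
    congr tsum; apply/funext => y; have [_ ->] := H y.
    by apply: eq_bigr => c _; rewrite mulrC.
  rewrite tsum_sum; last by move=> c _; apply: abs_summableZ.
  by apply: eq_bigr => c _; rewrite tsumZ // mulrC.
suff ind k x : independent_event Y (X k @^-1` [set x]) (future k).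
  by split=> [x|]; [exact: ind|have [] := step n (ind n)].
elim: k x => [|k IH] x; last by have [] := step k IH.
have [->|x0] := eqVneq x 0%N.
  have -> : X 0%N @^-1` [set 0%N] = setT.
    by apply/seteqP; split=> w //= _; apply: (inar_init hX).
  apply: independent_event_sub (independent_event_setT (inar_indep hX)).
  by move=> i [].
have -> : X 0%N @^-1` [set x] = set0.
  by apply/seteqP; split=> w //=; rewrite (inar_init hX) => E; rewrite -E eqxx in x0.
exact: independent_event0.
Qed.

End Recursion.

(** * The compound Poisson limit and convergence in distribution *)

Lemma compound_poisson_of_gf (R : realType) (lam : nat -> R)
    (mu : {finite_measure set nat -> \bar R}) (Q : probability nat R) q :
  (forall j, mu [set j] = (intensity lam j)%:E) ->
  abs_summable (intensity lam) ->
  (forall k, Q [set k] = (q k)%:E) -> pmf q ->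
  (forall z : R[i], `|z| <= 1 -> gf q z = cexp (log_gf lam z)) ->
  is_compound_poisson mu Q.
Proof.
move=> muE si QE [q0 sq _] hq z z1.
have -> : generating_function Q z = gf q z.
  apply: (@cvg_lim (R[i]^o)); first exact: norm_hausdorff.
  have -> : (fun k => (fine (Q [set k]))%:C%C * z ^+ k) =
      (fun k => (q k)%:C%C * z ^+ k) by apply/funext => k; rewrite QE.
  exact: gf_series.
rewrite hq //; congr cexp; apply/esym.
apply: (@cvg_lim (R[i]^o)); first exact: norm_hausdorff.
(* [is_compound_poisson] sums from j = 1 by a shift of index, whereas [log_gf] sums from 0 with a
   vanishing first term. *)
have shift (u : nat -> R) : u 0%N = 0 -> abs_summable u ->
    series (fun j => u j.+1) n @[n --> \oo] --> tsum u.
  move=> u0 /abs_summable_tsum; rewrite -(@cvg_shiftS R^o) => c.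
  apply: (eventually_eq_cvgn (N := 0%N) c) => n _.
  by rewrite /series /= big_nat_recl // u0 add0r.
have muE' j : fine (mu [set j.+1]) = intensity lam j.+1 by rewrite muE.
apply: cvg_complex.
- have sR := abs_summable_mulr si (fun j => (norm_exp_sub1 j z1).1).
  have u0 : intensity lam 0 * complex.Re (z ^+ 0 - 1) = 0 by rewrite mul0r.
  apply: (eventually_eq_cvgn (N := 0%N) (shift _ u0 sR)) => n _.
  by rewrite /series /= Re_sum; apply: eq_bigr => j _; rewrite ReZ muE'.
- have sI := abs_summable_mulr si (fun j => (norm_exp_sub1 j z1).2).
  have u0 : intensity lam 0 * complex.Im (z ^+ 0 - 1) = 0 by rewrite mul0r.
  apply: (eventually_eq_cvgn (N := 0%N) (shift _ u0 sI)) => n _.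
  by rewrite /series /= Im_sum; apply: eq_bigr => j _; rewrite ImZ muE'.
Qed.

Section Limits.
Context d (T : measurableType d) (R : realType) (P : probability T R).

Lemma weak_convergence_of_pmf (X : nat -> {RV P >-> nat}) (Q : probability nat R) q :
  (forall k, Q [set k] = (q k)%:E) -> pmf q ->
  (forall k, law (X n) k @[n --> \oo] --> q k) -> converges_in_distribution X Q.
Proof.
move=> QE qp hq f _ [M hM].
have -> : (fun n => \int[distribution P (X n)]_k (f k)%:E)%E =
    EFin \o (fun n => tsum (fun k => law (X n) k * f k)).
  by apply/funext => n; rewrite (integral_probability_nat _ hM).
rewrite (integral_probability_nat _ hM); apply: cvg_EFin; first exact: nearW.
have -> : tsum (fun k => fine (Q [set k]) * f k) = tsum (fun k => q k * f k).
  by congr tsum; apply/funext => k; rewrite QE.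
exact: (scheffe (fun n => rv_pmf (X n)) qp hq hM).
Qed.

Lemma factorial_momentE (eps : nat -> {RV P >-> nat}) n j :
  factorial_moment eps n j =
    (\sum_(0 <= k <oo) (law (eps n) k * (k ^_ j)%:R)%:E)%E.
Proof. by apply: (expectation_nat (eps n) (g := fun k => (k ^_ j)%:R)). Qed.

(** Convergence to a finite limit in the extended reals makes the products eventually finite, and a
    positive factor cannot make an infinite moment finite. *)
Lemma factorial_moment_limit (eps : nat -> {RV P >-> nat}) (c : nat -> R) j l :
  (forall n, 0 < c n.+1) ->
  (factorial_moment eps n j * (c n)%:E @[n --> \oo] --> l%:E)%E ->
  (exists N, forall n, (N <= n)%N ->
     abs_summable (fun k => law (eps n) k * (k ^_ j)%:R)) /\
  moment (law (eps n.+1)) j * c n.+1 @[n --> \oo] --> l.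
Proof.
move=> c0 /fine_cvgP[[N _ hN] hl].
have u0 n k : 0 <= law (eps n) k * (k ^_ j)%:R.
  by rewrite mulr_ge0 //; apply: pr_ge0.
have sm n : (N <= n.+1)%N -> abs_summable (fun k => law (eps n.+1) k * (k ^_ j)%:R).
  move=> /hN /= h; apply: nneseries_abs_summable => //.
  rewrite -factorial_momentE ltey; apply/eqP => E.
  by move: h; rewrite E gt0_mulye // lte_fin.
(* Index 0 is skipped: positivity of [c] is available only from index 1 on. *)
split; first by exists (maxn 1 N) => -[|n]; rewrite geq_max // => /andP[_ /sm].
move: hl; rewrite -(@cvg_shiftS R^o) => hl.
apply: (eventually_eq_cvgn (N := N) hl) => n Nn /=.
by rewrite factorial_momentE nneseries_tsum //; apply: sm; apply: leqW.
Qed.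

End Limits.

Theorem theorem5 (d : measure_display) (T : measurableType d) (R : realType)
  (P : probability T R)
  (xi : nat -> nat -> {RV P >-> nat}) (eps X : nat -> {RV P >-> nat})
  (lam : nat -> R)
  (hX : inhomogeneous_INAR1 xi eps X)
  (hrho_lt1 : forall n, (0 < n)%N -> offspring_mean xi n < 1)
  (hrho_lim : offspring_mean xi n @[n --> \oo] --> (1 : R))
  (hrho_sum : (\sum_(1 <= n <oo) (1 - offspring_mean xi n)%:E = +oo)%E)
  (hlam_ge0 : forall j, (0 < j)%N -> 0 <= lam j)
  (hlam : forall j, (0 < j)%N ->
    (factorial_moment eps n j * ((j%:R * (1 - offspring_mean xi n))^-1)%:E
       @[n --> \oo] --> (lam j)%:E)%E)
  (hmu : forall j, (0 < j)%N -> cvgn (series (intensity_term lam j))) :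
  exists mu : {finite_measure set nat -> \bar R},
    [/\ mu [set 0%N] = 0%E,
        (forall j, (0 < j)%N -> mu [set j] = (intensity_mass lam j)%:E) &
        exists Q : probability nat R,
          is_compound_poisson mu Q /\ converges_in_distribution X Q].
Proof.
have rho01 n : (0 < n)%N -> 0 <= offspring_mean xi n < 1.
  by move=> n0; rewrite hrho_lt1 // andbT; case/andP: (offspring_mean01 hX n0).
have c0 j n : (0 < j)%N -> 0 < (j%:R * (1 - offspring_mean xi n.+1))^-1 :> R.
  by move=> j0; rewrite invr_gt0 mulr_gt0 ?ltr0n ?subr_gt0 // hrho_lt1.
have e_pmf n : pmf (law (eps n)) := rv_pmf (eps n).
have e_moment j j0 := (factorial_moment_limit (fun n => c0 j n j0) (hlam j j0)).1.
have lam_lim j j0 := (factorial_moment_limit (fun n => c0 j n j0) (hlam j j0)).2.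
have X0 : law (X 0%N) = fun k => (k == 0%N)%:R.
  apply/funext => k; rewrite /law.
  have [->|k0] := eqVneq k 0%N.
    have -> : X 0%N @^-1` [set 0%N] = setT.
      by apply/seteqP; split=> w //= _; apply: (inar_init hX).
    by rewrite /pr probability_setT.
  have -> : X 0%N @^-1` [set k] = set0.
    by apply/seteqP; split=> w //=; rewrite (inar_init hX) => E; rewrite -E eqxx in k0.
  by rewrite /pr measure0.
have XS n := (inar_law hX n).2.
have [q [q_pmf q_lim q_gf]] := chain_cvg rho01 hrho_lim hrho_sum e_pmf e_moment
  lam_lim hmu X0 XS.
have i0 := intensity_ge0 rho01 hrho_lim hrho_sum e_pmf e_moment lam_lim hmu.
(* Only the summability of the intensity is extracted here, so the zero test function serves. *)
have [si _] := intensity_lim rho01 hrho_lim hrho_sum e_pmf e_moment lam_lim hmu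
  (phi := fun=> 0) (C := 0) (fun=> ltac:(by rewrite normr0)) erefl.
have [mu muE] := finite_measure_of_weights i0 si.
have [Q QE] := probability_of_pmf q_pmf.
exists mu; split.
- exact: muE.
- by case=> // j _; apply: muE.
- exists Q; split; first exact: compound_poisson_of_gf muE si QE q_pmf q_gf.
  exact: weak_convergence_of_pmf QE q_pmf q_lim.
Qed.
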